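(* Let $n\in\{3,4\}$ and let $f:\mathbb T^n\to\mathbb T^n$ be a partially hyperbolic diffeomorphism with splitting $T\mathbb T^n=E^s\oplus E^c\oplus E^u$ such that $\dim E^s=\dim E^c=1$. Suppose that $f$ is leaf conjugate to its linear part with respect to a center foliation $\mathcal W^c$, and suppose that there is a compact $cu$-submanifold $T$ of $f$. Then for every $x\in T$, the leaf $\mathcal W^c(x)$ of $\mathcal W^c$ through $x$ is not contained in $T$.
   Context: A diffeomorphism $f:M\to M$ of a closed connected Riemannian manifold is partially hyperbolic if $TM$ has a non-trivial $df$-invariant splitting $TM=E^s\oplus E^c\oplus E^u$ such that, for some Riemannian metric, $\|df|_{E^s}\|<1$, $\|df^{-1}|_{E^u}\|<1$, and for every $p\in M$ and unit vectors $v^\sigma\in E^\sigma_p$ ($\sigma=s,c,u$) one has $\|df_pv^s\|<\|df_pv^c\|<\|df_pv^u\|$. Write $E^{cu}=E^c\oplus E^u$. A $cu$-submanifold is an (injectively) immersed submanifold tangent to $E^{cu}$. The linear part of $f$ is the toral automorphism $N$ induced by $f_*:\pi_1(\mathbb T^n)\to\pi_1(\mathbb T^n)$. A center foliation $\mathcal W^c$ is an $f$-invariant foliation tangent to $E^c$. One says that $f$ is leaf conjugate to its linear part with respect to $\mathcal W^c$ if $N$ is partially hyperbolic (with one-dimensional stable and center bundles), and there is a homeomorphism $\psi:\mathbb T^n\to\mathbb T^n$ mapping leaves of $\mathcal W^c$ onto leaves of the linear center foliation of $N$ such that $\psi(f(\mathcal L))=N(\psi(\mathcal L))$ for every leaf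 $\mathcal L$ of $\mathcal W^c$. *)

(* Defs.v *)
From HB Require Import structures.
From mathcomp Require Import all_boot all_order all_algebra generic_quotient.
From mathcomp Require Import all_classical all_reals all_analysis.

Set Implicit Arguments.
Unset Strict Implicit.
Unset Printing Implicit Defensive.

Import Order.TTheory GRing.Theory Num.Theory.
Import numFieldNormedType.Exports.

Local Open Scope classical_set_scope.
Local Open Scope ring_scope.

Fixpoint Ck (R : realType) (V W : normedModType R) (k : nat) (f : V -> W) :
    Prop :=
  if k is k'.+1 then
    (forall x, differentiable f x) /\ (forall v, Ck k' (fun x => 'd f x v))
  else continuous f.

Definition smooth (R : realType) (V W : normedModType R) (f : V -> W) : Prop :=
  forall k, Ck k f.

Definition open_embedding (X Y : topologicalType) (h : X -> Y) : Prop :=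
  [/\ continuous h, injective h & forall U, open U -> open (h @` U)].

Definition int_lattice (R : realType) (n : nat) : {pred 'rV[R]_n} :=
  fun x => x \is a mxOver Num.int.

Fact int_lattice_zmod_closed (R : realType) (n : nat) :
  zmod_closed (@int_lattice R n).
Proof.
split=> [|x y /mxOverP xZ /mxOverP yZ]; apply/mxOverP => i j.
  by rewrite mxE rpred0.
by rewrite !mxE rpredB.
Qed.

Definition int_lattice_closed (R : realType) (n : nat) : zmodClosed 'rV[R]_n :=
  HB.pack (@int_lattice R n)
    (GRing.isZmodClosed.Build 'rV[R]_n (@int_lattice R n)
       (@int_lattice_zmod_closed R n)).

(* R^n / Z^n. Its tangent spaces are all identified with R^n by means of the  *)
(* projection [tpi], a local diffeomorphism. Hence the derivative of a C^1    *)
(* map of tori at [tpi x] is the differential at x of any of its lifts, and a *)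
(* subbundle of the tangent bundle is a family of subspaces of R^n.           *)
Definition torus (R : realType) (n : nat) : topologicalType :=
  quotient_topology (Quotient.quot (int_lattice_closed R n)).

Definition tpi (R : realType) (n : nat) (x : 'rV[R]_n) : torus R n :=
  (\pi_(torus R n) x)%qT.

Section PartialHyperbolicity.
Variables (R : realType) (n : nat).
Implicit Types (f : torus R n -> torus R n) (F : 'rV[R]_n -> 'rV[R]_n).
Implicit Types (E : torus R n -> {vspace 'rV[R]_n}).

Definition C1_lift f F : Prop := Ck 1 F /\ forall x, tpi (F x) = f (tpi x).

(* A local frame around each point, by continuous vector fields; k is the     *)
(* rank.                                                                      *)
Definition subbundle E : Prop :=
  exists k : nat, forall p : torus R n,
    exists X : 'I_k -> torus R n -> 'rV[R]_n,
    \forall q \near p, basis_of (E q) [tuple X i q | i < k] /\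
      forall i, {for q, continuous (X i)}.

Definition splitting (Es Ec Eu : torus R n -> {vspace 'rV[R]_n}) : Prop :=
  [/\ subbundle Es, subbundle Ec & subbundle Eu] /\
  forall p, directv (Es p + Ec p + Eu p) /\
    (Es p + Ec p + Eu p)%VS = fullv.

(* E is invariant under the derivative of the map lifted by F. *)
Definition invariant_bundle F E : Prop :=
  forall x, (linfun ('d F x) @: E (tpi x))%VS = E (tpi (F x)).

Definition metric_form (g : torus R n -> 'M[R]_n) (p : torus R n)
  (v w : 'rV[R]_n) : R := (v *m g p *m w^T) 0 0.

Definition riemannian_metric (g : torus R n -> 'M[R]_n) : Prop :=
  [/\ forall i j, smooth (fun x : 'rV[R]_n => g (tpi x) i j : R^o),
      forall p v w, metric_form g p v w = metric_form g p w v
    & forall p v, v != 0 -> 0 < metric_form g p v v].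

Definition metric_norm (g : torus R n -> 'M[R]_n) (p : torus R n)
  (v : 'rV[R]_n) : R := Num.sqrt (metric_form g p v v).

(* The operator norm of the restriction to E of the derivative of the map     *)
(* lifted by F.                                                               *)
Definition bundle_opnorm (g : torus R n -> 'M[R]_n) F E : \bar R :=
  ereal_sup [set r | exists x v, [/\ v \in E (tpi x),
    metric_norm g (tpi x) v = 1 &
    r = (metric_norm g (tpi (F x)) ('d F x v))%:E]].

Definition partially_hyperbolic f
    (Es Ec Eu : torus R n -> {vspace 'rV[R]_n}) : Prop :=
  splitting Es Ec Eu /\
  (forall p, [/\ Es p != 0%VS, Ec p != 0%VS & Eu p != 0%VS]) /\
  exists f' F F',
  [/\ cancel f f', cancel f' f, C1_lift f F & C1_lift f' F'] /\
  [/\ invariant_bundle F Es, invariant_bundle F Ec & invariant_bundle F Eu] /\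
  exists g, riemannian_metric g /\
  [/\ (bundle_opnorm g F Es < 1)%E, (bundle_opnorm g F' Eu < 1)%E &
    forall x vs vc vu,
      vs \in Es (tpi x) -> vc \in Ec (tpi x) -> vu \in Eu (tpi x) ->
      metric_norm g (tpi x) vs = 1 ->
      metric_norm g (tpi x) vc = 1 ->
      metric_norm g (tpi x) vu = 1 ->
      metric_norm g (tpi (F x)) ('d F x vs)
        < metric_norm g (tpi (F x)) ('d F x vc)
        < metric_norm g (tpi (F x)) ('d F x vu)].

(* i is an injective C^1 immersion, tangent to E, of the d-dimensional        *)
(* manifold S onto T. The parametrizations h of S form the atlas of S for     *)
(* which i is an immersion: as both i \o h and i \o h' are C^1 immersions,    *)
(* the changes of coordinates are C^1.                                        *)
Definition tangent_immersion (d : nat) (S : topologicalType)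
    (i : S -> torus R n) E (T : set (torus R n)) : Prop :=
  [/\ hausdorff_space S, second_countable (T := S), injective i, range i = T &
    forall s : S, exists (h : 'rV[R]_d -> S) (H : 'rV[R]_d -> 'rV[R]_n),
      [/\ open_embedding h, range h s, Ck 1 H,
        forall u, tpi (H u) = i (h u) &
        forall u, (lker (linfun ('d H u)) == 0%VS) /\
          limg (linfun ('d H u)) = E (tpi (H u))]].

Definition compact_submanifold E (T : set (torus R n)) : Prop :=
  exists (d : nat) (S : topologicalType) (i : S -> torus R n),
    compact [set: S] /\ tangent_immersion d i E T.

Definition compact_cu_submanifold (Ec Eu : torus R n -> {vspace 'rV[R]_n})
    (T : set (torus R n)) : Prop :=
  compact_submanifold (fun p => Ec p + Eu p)%VS T.

(* A d-dimensional foliation with C^1 leaves tangent to E; W x is the leaf    *)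
(* through x. In a chart phi, the plaques are the images of the slices        *)
(* R^d * {t}; they are the connected components of the intersections of the   *)
(* leaves with the domain of the chart.                                       *)
Definition foliation (d : nat) E (W : torus R n -> set (torus R n)) : Prop :=
  [/\ forall x, W x x,
      forall x y, W x y -> W y = W x,
      forall x, exists (S : topologicalType) (i : S -> torus R n),
        connected [set: S] /\ tangent_immersion d i E (W x) &
      forall x, exists phi : 'rV[R]_d * 'rV[R]_(n - d) -> torus R n,
        [/\ open_embedding phi, range phi x &
          forall s t, connected_component (W (phi (s, t)) `&` range phi)
                        (phi (s, t)) =
                      range (fun s' => phi (s', t))]].

Definition center_foliation f Ec (W : torus R n -> set (torus R n)) : Prop :=
  foliation 1 Ec W /\ forall x, f @` W x = W (f x).

(* pi_1(T^n) is identified with Z^n: the class of a loop is the difference of *)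
(* the endpoints of its lifts.                                                *)
Definition loop_class (gamma : R -> torus R n) (k : 'rV[int]_n) : Prop :=
  exists c : R -> 'rV[R]_n,
    [/\ {within `[0, 1], continuous c},
        forall t, `[0, 1]%classic t -> tpi (c t) = gamma t &
        c 1 - c 0 = map_mx intr k].

Definition pi1_matrix f (A : 'M[int]_n) : Prop :=
  forall gamma k, loop_class gamma k -> loop_class (f \o gamma) (k *m A).

Definition toral_map (A : 'M[int]_n) (p : torus R n) : torus R n :=
  tpi ((repr p : 'rV[R]_n) *m map_mx intr A).

Definition linear_leaf (V : {vspace 'rV[R]_n}) (p : torus R n) :
    set (torus R n) :=
  [set tpi ((repr p : 'rV[R]_n) + v) | v in [set v | v \in V]].

(* The splitting of a partially hyperbolic toral automorphism is by constant  *)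
(* subbundles.                                                                *)
Definition leaf_conjugate_to_linear f (W : torus R n -> set (torus R n)) :
    Prop :=
  exists (A : 'M[int]_n) (Vs Vc Vu : {vspace 'rV[R]_n}),
  [/\ pi1_matrix f A,
      partially_hyperbolic (toral_map A)
        (fun=> Vs) (fun=> Vc) (fun=> Vu),
      \dim Vs = 1%N /\ \dim Vc = 1%N &
      exists psi psi' : torus R n -> torus R n,
      [/\ continuous psi, continuous psi', cancel psi psi', cancel psi' psi &
          forall x, psi @` W x = linear_leaf Vc (psi x) /\
            psi @` (f @` W x) = toral_map A @` (psi @` W x)]].

End PartialHyperbolicity.

(* Main.v *)
(** Write [T_k] for the preimage of [T] under [f^k]; it is again closed and
    tangent to [Ecu = Ec + Eu].  If [z] is close to [T_k], a point [q] of [T_k]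
    closest to [z] (for a norm adapted to [Es + Ecu] at [z]) satisfies
    [z - q \in Es], for otherwise one could approach [z] by moving [q] inside
    [T_k] in an [Ecu] direction.  Hence applying [f] contracts the distance, and
    a point whose whole backward orbit stays uniformly close to the [T_k] lies
    in the closed set [T].

    Suppose that [T] contains a center leaf, and let [psi] be the leaf
    conjugacy to the linear map [N].  Points on a nearby linear center leaf in
    an unstable direction of [N] have, by uniform continuity of [psi^-1], a
    backward orbit close to that of the given leaf, hence they belong to
    [psi T].  Consequently [psi T] contains a whole leaf of the linear
    center-unstable foliation.  Such a leaf is dense: the stable components of
    [m N^k], for a suitable integer vector [m], are nonzero and tend to [0] in
    the one-dimensional stable line.  So [T] is the whole torus, which is
    impossible because a submanifold tangent to [Ecu] contains no neighbourhood
    of any of its points in the [Es] direction. *)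
Require Import Defs.
From mathcomp Require Import all_boot all_order all_algebra generic_quotient.
From mathcomp Require Import all_classical all_reals all_analysis.
From mathcomp Require Import ring lra zify.

Set Implicit Arguments.
Unset Strict Implicit.
Unset Printing Implicit Defensive.

Import Order.TTheory GRing.Theory Num.Theory.
Import numFieldNormedType.Exports.

Local Open Scope classical_set_scope.
Local Open Scope ring_scope.

(** * Limits of matrices *)

Section MatrixAnalysis.
Variable R : realType.

Lemma entry_le_norm m n (M : 'M[R]_(m, n)) i j : `|M i j| <= `|M|.
Proof.
by rewrite [leRHS]/Num.norm /= mx_normrE; apply/bigmax_geP; right => /=; exists (i, j).
Qed.

Lemma norm_le_entries m n (M : 'M[R]_(m, n)) c : 0 <= c ->
  (forall i j, `|M i j| <= c) -> `|M| <= c.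
Proof.
move=> c0 Mc; rewrite [leLHS]/Num.norm /= mx_normrE.
by apply/bigmax_leP; split => // -[i j] _; exact: Mc.
Qed.

Lemma norm_mulmx m n p (A : 'M[R]_(m, n)) (B : 'M[R]_(n, p)) :
  `|A *m B| <= n%:R * `|A| * `|B|.
Proof.
apply: norm_le_entries => [|i j]; first by rewrite !mulr_ge0.
rewrite mxE (le_trans (ler_norm_sum _ _ _))//.
rewrite (@le_trans _ _ (\sum_(k < n) `|A| * `|B|))//.
  apply: ler_sum => k _; rewrite normrM.
  by apply: ler_pM => //; exact: entry_le_norm.
by rewrite sumr_const card_ord -mulrA mulr_natl.
Qed.

Lemma cvg_entries (T : Type) (F : set_system T) {FF : Filter F} m n
    (A : T -> 'M[R]_(m, n)) (B : 'M[R]_(m, n)) :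
  (forall i j, A x i j @[x --> F] --> B i j) -> A x @[x --> F] --> B.
Proof.
move=> AB; apply/cvgrPdist_le => e e0.
have H i j : \forall x \near F, `|B i j - A x i j| <= e.
  by have /cvgrPdist_le/(_ e e0) := AB i j.
have {}H : \forall x \near F, forall ij : 'I_m * 'I_n,
    `|B ij.1 ij.2 - A x ij.1 ij.2| <= e.
  by apply: filter_forall => -[i j]; exact: H.
apply: filterS H => x H; apply: norm_le_entries; first exact: ltW.
by move=> i j; rewrite !mxE; exact: (H (i, j)).
Qed.

Lemma cvg_entry (T : Type) (F : set_system T) {FF : Filter F} m n
    (A : T -> 'M[R]_(m, n)) (B : 'M[R]_(m, n)) i j :
  A x @[x --> F] --> B -> A x i j @[x --> F] --> B i j.
Proof.
by move=> AB; apply: (@cvg_comp _ _ _ A (fun M => M i j) _ _ _ AB); exact: coord_continuous.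
Qed.

Lemma cvg_sumr (T : Type) (F : set_system T) {FF : Filter F} (I : Type)
    (r : seq I) (f : I -> T -> R) (l : I -> R) :
  (forall i, f i x @[x --> F] --> l i) ->
  \sum_(i <- r) f i x @[x --> F] --> \sum_(i <- r) l i.
Proof.
move=> fl; elim: r => [|i r IH].
  by under eq_fun do rewrite big_nil; rewrite big_nil; exact: cvg_cst.
under eq_fun do rewrite big_cons; rewrite big_cons.
exact: cvgD.
Qed.

Lemma cvg_prodr (T : Type) (F : set_system T) {FF : Filter F} (I : Type)
    (r : seq I) (f : I -> T -> R) (l : I -> R) :
  (forall i, f i x @[x --> F] --> l i) ->
  \prod_(i <- r) f i x @[x --> F] --> \prod_(i <- r) l i.
Proof.
move=> fl; elim: r => [|i r IH].
  by under eq_fun do rewrite big_nil; rewrite big_nil; exact: cvg_cst.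
under eq_fun do rewrite big_cons; rewrite big_cons.
exact: cvgM.
Qed.

Lemma cvg_mulmx (T : Type) (F : set_system T) {FF : Filter F} m n p
    (A : T -> 'M[R]_(m, n)) (B : T -> 'M[R]_(n, p))
    (A0 : 'M[R]_(m, n)) (B0 : 'M[R]_(n, p)) :
  A x @[x --> F] --> A0 -> B x @[x --> F] --> B0 ->
  A x *m B x @[x --> F] --> A0 *m B0.
Proof.
move=> AA BB; apply: cvg_entries => i j; rewrite mxE.
under eq_fun do rewrite mxE.
by apply: cvg_sumr => k; apply: cvgM; exact: cvg_entry.
Qed.

Lemma cvg_det (T : Type) (F : set_system T) {FF : Filter F} n
    (A : T -> 'M[R]_n) (A0 : 'M[R]_n) :
  A x @[x --> F] --> A0 -> \det (A x) @[x --> F] --> \det A0.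
Proof.
move=> AA; apply: cvg_sumr => s; apply: cvgM; first exact: cvg_cst.
by apply: cvg_prodr => i; exact: cvg_entry.
Qed.

(** Cramer's rule writes the entries of the inverse as cofactors divided by the determinant. These
    are rational in the entries of the matrix, and the limit of the denominators is nonzero. *)
Lemma cvg_invmx (T : Type) (F : set_system T) {FF : Filter F} n
    (A : T -> 'M[R]_n) (A0 : 'M[R]_n) : A0 \in unitmx ->
  A x @[x --> F] --> A0 -> invmx (A x) @[x --> F] --> invmx A0.
Proof.
move=> uA0 AA.
have dA0 : \det A0 != 0 by rewrite -unitfE -unitmxE.
have dA : \det (A x) @[x --> F] --> \det A0 by exact: cvg_det.
have uA : \forall x \near F, A x \in unitmx.
  by have := @cvgr_neq0 R R T F FF _ _ dA dA0; apply: filterS => x; rewrite unitmxE unitfE.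
have invE i j (B : 'M[R]_n) : B \in unitmx ->
    (\det B)^-1 * cofactor B j i = invmx B i j.
  by rewrite /invmx => ->; rewrite !mxE.
apply: cvg_entries => i j; rewrite -invE //.
have E : \forall x \near F,
    (\det (A x))^-1 * cofactor (A x) j i = invmx (A x) i j.
  by apply: filterS uA => x; exact: invE.
apply: (cvg_trans (near_eq_cvg E)).
apply: cvgM; first exact: cvgV.
apply: cvgM; first exact: cvg_cst.
apply: cvg_det; apply: cvg_entries => k l; rewrite !mxE.
by under eq_fun do rewrite !mxE; exact: cvg_entry.
Qed.

End MatrixAnalysis.

(** * The torus *)

Section Torus.
Variables (R : realType) (n : nat).
Implicit Types (x y m : 'rV[R]_n).
Local Notation Zn := (@int_lattice R n).

Lemma int_lattice0 : Zn 0. Proof. exact: (int_lattice_zmod_closed R n).1. Qed.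

Lemma int_latticeB x y : Zn x -> Zn y -> Zn (x - y).
Proof. exact: (int_lattice_zmod_closed R n).2. Qed.

Lemma int_latticeN x : Zn x -> Zn (- x).
Proof. by move=> Zx; rewrite -sub0r; exact: int_latticeB int_lattice0 Zx. Qed.

Lemma int_lattice_lt1 x : Zn x -> `|x| < 1 -> x = 0.
Proof.
move=> /mxOverP Zx x1; apply/matrixP => i j; rewrite mxE.
apply/eqP; apply: contraTT x1 => xij0; rewrite -leNgt.
by rewrite (le_trans (norm_intr_ge1 (Zx i j) xij0))// entry_le_norm.
Qed.

Lemma tpiP x y : tpi x = tpi y <-> Zn (x - y).
Proof.
have E := Quotient.idealrBE (int_lattice_closed R n) x y.
split => [xy|xy]; last first.
  by have : x - y \in int_lattice_closed R n := xy; rewrite E => /eqP.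
by have : x - y \in int_lattice_closed R n by rewrite E; apply/eqP; exact: xy.
Qed.

Lemma tpiD x m : Zn m -> tpi (x + m) = tpi x.
Proof. by move=> Zm; apply/tpiP; rewrite addrC addKr. Qed.

Lemma tpi_repr (p : torus R n) : tpi (repr p) = p.
Proof. by rewrite /tpi reprK. Qed.

Lemma repr_tpi x : exists2 m, Zn m & repr (tpi x) = x + m.
Proof.
exists (repr (tpi x) - x); last by rewrite addrC subrK.
by apply/tpiP; rewrite tpi_repr.
Qed.

Lemma tpi_continuous : continuous (@tpi R n).
Proof. exact: pi_continuous. Qed.

Lemma tpi_open (U : set 'rV[R]_n) : open U -> open (@tpi R n @` U).
Proof.
move=> oU; rewrite /open /= /quotient_open.
rewrite (_ : _ @^-1` _ =
    \bigcup_(m in [set m | Zn m]) ((fun z : 'rV[R]_n => z + m) @^-1` U)).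
  apply: bigcup_open => m _.
  have /continuousP : continuous (fun z : 'rV[R]_n => z + m); last exact.
  by move=> z; apply: (@continuousD _ _ _ id (cst m)); [exact: cvg_id|exact: cst_continuous].
apply/seteqP; split => x /=.
  by move=> [y Uy /tpiP Zyx]; exists (y - x) => //=; rewrite addrC subrK.
by move=> [m Zm /= Uxm]; exists (x + m) => //; exact: tpiD.
Qed.

Lemma nbhs_tpi x (U : set 'rV[R]_n) : nbhs x U -> nbhs (tpi x) (@tpi R n @` U).
Proof.
move=> /nbhs_interior/nbhs_singleton Ux; rewrite nbhsE /=.
exists (@tpi R n @` U^°); first by split; [exact/tpi_open/open_interior|exists x].
by apply: image_subset; exact: interior_subset.
Qed.

(** If all neighbourhoods of two points meet, lifts of these points become arbitrarily close after
    lattice translations. As the lattice is discrete, some translation makes them equal. *)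
Lemma torus_hausdorff : hausdorff_space (torus R n).
Proof.
move=> p q; rewrite -(tpi_repr p) -(tpi_repr q) => pq.
set x : 'rV[R]_n := repr p in pq *; set y : 'rV[R]_n := repr q in pq *.
have close e : 0 < e -> exists2 m, Zn m & `|x - y + m| < e.
  move=> e0.
  have e20 : 0 < e / 2 by rewrite divr_gt0.
  have [z []] := pq _ _ (nbhs_tpi (nbhsx_ballx x _ e20)) (nbhs_tpi (nbhsx_ballx y _ e20)).
  move=> [x' xx' <-] [y' yy' /tpiP Z]; exists (y' - x') => //.
  rewrite -ball_normE /= in xx' yy'.
  rewrite (_ : x - y + (y' - x') = (x - x') - (y - y')); last first.
    by rewrite opprB addrACA [RHS]addrACA [- y + _]addrC [- x' + _]addrC.
  by rewrite (le_lt_trans (ler_normB _ _))// [ltRHS]splitr ltrD.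
(* If the translate by [m], of size below 1/2, is nonzero, a still smaller one by [m'] exists. Then
   [m - m'] is a lattice vector of norm below 1, so [m = m'], a contradiction. *)
have [m Zm m2] := close 2^-1 ltac:(rewrite invr_gt0; exact: ltr0n).
have [xym0|xym0] := eqVneq (x - y + m) 0.
  by apply/tpiP; rewrite -[x - y](addrK m) xym0 sub0r; exact: int_latticeN.
have [|m' Zm' m'm] := close `|x - y + m|; first by rewrite normr_gt0.
suff /eqP : m - m' = 0 by rewrite subr_eq0 => /eqP mm'; rewrite mm' ltxx in m'm.
apply: int_lattice_lt1; first exact: int_latticeB.
rewrite (_ : m - m' = (x - y + m) - (x - y + m')); last first.
  by rewrite opprD addrACA subrr add0r.
by rewrite (le_lt_trans (ler_normB _ _))// [ltRHS]splitr div1r ltrD// (lt_trans m'm).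
Qed.

(** The unit cube is compact and meets every class modulo the lattice. A periodic property that
    holds locally for all parameters near the limit therefore holds globally. *)
Lemma periodic_near (I : Type) (F : set_system I) {FF : Filter F}
    (P : I -> 'rV[R]_n -> Prop) :
  (forall i x m, Zn m -> P i x -> P i (x + m)) ->
  (forall x, \forall x' \near x & i \near F, P i x') ->
  \forall i \near F, forall x, P i x.
Proof.
move=> Pper Pnear.
have cK := @rV_compact R n (fun=> `[0, 1]%classic) (fun=> @segment_compact R 0 1).
have /compact_near_coveringP/(_ I F P FF (fun x _ => Pnear x)) := cK.
apply: filterS => i Pi x.
pose m : 'rV[R]_n := \row_j (Num.floor (x 0 j))%:~R.
have Zm : Zn m by apply/mxOverP => k j; rewrite mxE intr_int.
rewrite -(subrK m x); apply: Pper => //; apply: Pi => j /=.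
rewrite !mxE in_itv /= subr_ge0 floor_le /=.
by have := floorD1_gt (x 0 j); rewrite intrD lerBlDl => /ltW.
Qed.

(** This applies to differences of two lifts of the same map: lifts agree locally up to a fixed
    translation, hence have the same differential. *)
Lemma continuous_int_locally_constant (T : topologicalType) (u : T -> 'rV[R]_n) :
  continuous u -> (forall t, Zn (u t)) -> forall t, \forall t' \near t, u t' = u t.
Proof.
move=> cu Zu t; have /cvgrPdist_lt/(_ 1 ltr01) := cu t.
apply: filterS => t' tt'; apply/esym/eqP; rewrite -subr_eq0; apply/eqP.
by apply: int_lattice_lt1 => //; exact: int_latticeB.
Qed.

End Torus.

(** * Differential calculus *)

Section Calculus.
Variable R : realType.

Lemma diff_mxE d n (F : 'rV[R]_d -> 'rV[R]_n) x v : 'd F x v = v *m 'J F x.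
Proof. by rewrite /jacobian mul_rV_lin1. Qed.

Lemma diff_near (V W : normedModType R) (F : V -> W) x : differentiable F x ->
  forall e : R, 0 < e ->
  \forall h \near (0 : V), `|F (x + h) - F x - 'd F x h| <= e * `|h|.
Proof.
move=> dF e e0; have /eqaddoP/(_ e e0) := diff_locally dF.
apply: filterS => h; rewrite /= !fctE /= opprD addrA [h + x]addrC.
exact.
Qed.

Lemma diff_eq_near (V W : normedModType R) (F G : V -> W) x y :
  differentiable F x -> differentiable G y ->
  (\forall h \near (0 : V), F (x + h) - F x = G (y + h) - G y) ->
  'd F x =1 'd G y.
Proof.
move=> dF dG FG v; apply/eqP; rewrite -subr_eq0 -normr_le0.
apply/ler_addgt0Pl => e e0; rewrite addr0.
(* The factor 2 accounts for the two linearization errors, and the term [|v| + 1] turns errors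
   relative to [t *: v] into errors relative to [t]. *)
have d0 : 0 < e / (2 * (`|v| + 1)) by rewrite divr_gt0// mulr_gt0// ltr_wpDl.
have cv : (fun t : R => t *: v) @ 0 --> (0 : V).
  by rewrite -[X in _ --> X](scale0r v); exact: scalel_continuous.
have /nbhs_ballP[r r0 Hr] : nbhs (0 : R) [set t | [/\
    F (x + t *: v) - F x = G (y + t *: v) - G y,
    `|F (x + t *: v) - F x - 'd F x (t *: v)| <=
      e / (2 * (`|v| + 1)) * `|t *: v| &
    `|G (y + t *: v) - G y - 'd G y (t *: v)| <=
      e / (2 * (`|v| + 1)) * `|t *: v| ]].
  have := cv _ (diff_near dG d0); have := cv _ (diff_near dF d0).
  have := cv _ FG; by apply: (@filterS3 _ (nbhs (0 : R))) => t; split.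
have r20 : 0 < r / 2 by rewrite divr_gt0.
have /Hr /= [E E1 E2] : ball (0 : R) r (r / 2).
  by rewrite -ball_normE /= sub0r normrN gtr0_norm// ltr_pdivrMr// ltr_pMr// ltr1n.
rewrite -E in E2.
have : `|(r / 2) *: ('d F x v - 'd G y v)| <=
    (e / (2 * (`|v| + 1))) * (r / 2 * `|v|) *+ 2.
  rewrite scalerBr -!linearZ /=.
  set a := F _ - F _ in E1 E2; set b := 'd F x _ in E1 *; set c := 'd G y _ in E2 *.
  rewrite (_ : b - c = (a - c) - (a - b)); last by rewrite opprB [RHS]addrC addrA subrK.
  rewrite mulr2n (le_trans (ler_normB _ _))//.
  by rewrite normrZ (gtr0_norm r20) in E1 E2; exact: lerD.
rewrite normrZ (gtr0_norm r20) mulrCA -mulrnAr -[X in _ <= _ * X]mulr_natr.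
rewrite ler_pM2l// => /le_trans; apply.
have -> : e / (2 * (`|v| + 1)) * `|v| * 2 = e * (`|v| / (`|v| + 1)).
  by field; rewrite gt_eqF// ltr_wpDl.
by rewrite ler_piMr ?(ltW e0)// ler_pdivrMr ?ltr_wpDl// mul1r lerDl.
Qed.

Lemma jacobian_continuous d n (F : 'rV[R]_d -> 'rV[R]_n) :
  Ck 1 F -> continuous (fun x => 'J F x).
Proof.
move=> [_ cF] x; apply: (@cvg_entries R _ (nbhs x)) => i j.
have E y : 'J F y i j = 'd F y (delta_mx 0 i) 0 j by rewrite diff_mxE -rowE [RHS]mxE.
have H : 'd F y (delta_mx 0 i) 0 j @[y --> x] --> 'd F x (delta_mx 0 i) 0 j.
  by apply: (@cvg_entry R _ (nbhs x)); exact: cF.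
exact: (eq_ind_r (fun u : 'rV[R]_d -> R => u @ x --> u x) H (funext E)).
Qed.

Lemma is_derive_coord_line d n (F : 'rV[R]_d -> 'rV[R]_n) (y v : 'rV[R]_d)
    (t : R) j : differentiable F (y + t *: v) ->
  is_derive t 1 (fun s : R => F (y + s *: v) 0 j) ((v *m 'J F (y + t *: v)) 0 j).
Proof.
move=> dF; pose l (s : R) : 'rV[R]_d := y + s *: v.
have dl : is_derive t 1 l v.
  have dsc : is_diff t ( *:%R^~ v) ( *:%R^~ v) by exact: is_diff_scalel.
  have dsc1 : is_derive t 1 ( *:%R^~ v) v.
    by split; [exact: diff_derivable|rewrite deriveE// diff_val scale1r].
  by rewrite -[v in is_derive _ _ _ v]add0r; exact: (is_deriveD (is_derive_cst _ _ _) dsc1).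
have dlt : differentiable l t by apply/derivable1_diffP.
have dFl : derivable (F \o l) t 1.
  by apply/derivable1_diffP; apply: differentiable_comp.
split; first exact: (derivable_mxP (F \o l) t 1).1 dFl 0 j.
have <- : 'D_1 (F \o l) t = v *m 'J F (y + t *: v).
  rewrite deriveE; last exact/derivable1_diffP.
  rewrite diff_comp//= -diff_mxE -(@deriveE _ _ _ l)//.
  by rewrite (@derive_val _ _ _ _ _ _ _ dl).
by rewrite derive_mx // mxE.
Qed.

Lemma is_derive_sub_linear (u : R -> R) (t a b : R) :
  is_derive t 1 u a -> is_derive t 1 (fun s => u s - s * b) (a - b).
Proof.
move=> du; apply: is_deriveB.
rewrite -[X in is_derive _ _ _ X]mulr1.
have -> : (fun s : R => s * b) = b \*: id.
  by apply/funext => s; rewrite mulrC.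
exact: is_deriveZ.
Qed.

(** The scalar mean value theorem is applied on [0, 1] to each coordinate of
    [F (y + t *: v) - t *: (v *m J)]. The factor [d] comes from the bound on matrix products in the
    sup norm. *)
Lemma mean_value d n (F : 'rV[R]_d -> 'rV[R]_n) (J : 'M[R]_(d, n)) c x y :
  (forall z, differentiable F z) ->
  (forall t, 0 <= t <= 1 -> `|'J F (y + t *: (x - y)) - J| <= c) ->
  `|F x - F y - (x - y) *m J| <= d%:R * c * `|x - y|.
Proof.
move=> dF FJ; set v := x - y.
have c0 : 0 <= c by apply: le_trans (FJ 0 _) => //; rewrite lexx ler01.
apply: norm_le_entries => [|i j]; first by rewrite !mulr_ge0.
rewrite (ord1 i) {i}.
pose l (t : R) : 'rV[R]_d := y + t *: v.
pose u (t : R) : R := F (l t) 0 j - t * (v *m J) 0 j.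
have du (t : R) : is_derive t 1 u ((v *m ('J F (l t) - J)) 0 j).
  have -> : (v *m ('J F (l t) - J)) 0 j = (v *m 'J F (l t)) 0 j - (v *m J) 0 j.
    by rewrite mulmxBr [LHS]mxE [X in _ + X]mxE.
  by apply: is_derive_sub_linear; exact: is_derive_coord_line.
have cu : {within `[0, 1], continuous u}.
  apply: continuous_subspaceT => t; apply: differentiable_continuous.
  by apply/derivable1_diffP; exact: (@ex_derive _ _ _ _ _ _ _ (du t)).
have [t] := @MVT R u _ 0 1 ltr01 (fun t _ => du t) cu.
rewrite in_itv /= => /andP[t0 t1].
rewrite /u /l scale1r scale0r addr0 mul0r mul1r subr0 [y + v]addrC subrK subr0 mulr1.
move=> E; have -> : (F x - F y - v *m J) 0 j = (v *m ('J F (l t) - J)) 0 j.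
  by rewrite -E [LHS]mxE [X in X + _]mxE [X in _ + X + _]mxE [X in _ + X]mxE addrAC.
rewrite (le_trans (entry_le_norm _ _ _))// (le_trans (norm_mulmx _ _))//.
rewrite -!mulrA ler_wpM2l// [leRHS]mulrC ler_wpM2l//.
by apply: FJ; rewrite !ltW.
Qed.

End Calculus.

(** * Lifts of torus maps *)

Section Lifts.
Variables (R : realType) (n : nat).
Implicit Types (f : torus R n -> torus R n) (F : 'rV[R]_n -> 'rV[R]_n).
Implicit Types x y z m k v : 'rV[R]_n.
Local Notation Zn := (@int_lattice R n).

(** This is the Lebesgue number argument for the cover by the sets [U], made uniform over the whole
    space by periodicity. *)
Lemma periodic_lebesgue_number (Q : 'rV[R]_n -> 'rV[R]_n -> Prop) :
  (forall x y m, Zn m -> Q x y -> Q (x + m) (y + m)) ->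
  (forall x0 : 'rV[R]_n, exists2 U, nbhs x0 U & forall x y, U x -> U y -> Q x y) ->
  exists2 r : R, 0 < r & forall x y, `|x - y| <= r -> Q x y.
Proof.
move=> Qper Qloc.
have H : \forall r \near (0 : R)^'+, forall x y, `|x - y| <= r -> Q x y.
  apply: periodic_near => [r x m Zm H y xy|x0].
    by rewrite -[y](subrK m); apply: Qper => //; apply: H; rewrite opprB addrA.
  have [U /nbhs_ballP[e /= e0 eU] UQ] := Qloc x0.
  have e20 : 0 < e / 2 by rewrite divr_gt0.
  exists (ball x0 (e / 2), [set r | r < e / 2]) => /=.
    by split; [exact: nbhsx_ballx|exact: nbhs_right_lt].
  move=> [x r] /= [x0x re] y xy; apply: UQ; apply: eU.
    by apply: le_ball x0x; rewrite ler_pdivrMr// ler_pMr// ler1n.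
  rewrite -ball_normE /= in x0x *.
  rewrite -(subrKA x) (le_lt_trans (ler_normD _ _))// [ltRHS]splitr ltrD//.
  exact: le_lt_trans xy re.
have [r [r0 Hr]] : exists r : R, 0 < r /\ forall x y, `|x - y| <= r -> Q x y.
  by near (0 : R)^'+ => r; exists r; split => //; near: r.
by exists r.
Unshelve. all: by end_near. Qed.

Lemma periodic_unif_continuous (W : normedModType R) (u : 'rV[R]_n -> W) :
  continuous u -> (forall x m, Zn m -> u (x + m) = u x) ->
  forall e : R, 0 < e ->
  exists2 r : R, 0 < r & forall x y, `|x - y| <= r -> `|u x - u y| <= e.
Proof.
move=> cu uper e e0; apply: periodic_lebesgue_number.
  by move=> x y m Zm; rewrite !uper.
move=> x0; have e20 : 0 < e / 2 by rewrite divr_gt0.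
have /cvgrPdist_le/(_ _ e20) U := cu x0.
exists [set y | `|u x0 - u y| <= e / 2] => //= x y xx yy.
rewrite -(subrKA (u x0)) (le_trans (ler_normD _ _))// [leRHS]splitr.
by rewrite lerD// distrC.
Qed.

(** A periodic continuous Jacobian is uniformly continuous, so the mean value inequality has the
    same small constant at all points. Dividing by [n%:R + 1] absorbs its dimensional factor. *)
Lemma C1_unif_differentiable F : Ck 1 F ->
  (forall x m, Zn m -> 'J F (x + m) = 'J F x) ->
  forall e : R, 0 < e -> exists2 r : R, 0 < r &
    forall x y, `|x - y| <= r -> `|F x - F y - 'd F x (x - y)| <= e * `|x - y|.
Proof.
move=> CF Jper e e0.
have n0 : 0 < n%:R + 1 :> R by rewrite ltr_wpDl.
have d0 : 0 < e / (n%:R + 1) by rewrite divr_gt0.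
have [r r0 Hr] := periodic_unif_continuous (jacobian_continuous CF) Jper d0.
exists r => // x y xy; rewrite diff_mxE.
have := @mean_value R n n F ('J F x) (e / (n%:R + 1)) x y CF.1.
move=> /(_ _)/le_trans; apply.
  move=> t /andP[t0 t1]; rewrite distrC; apply: Hr.
  rewrite opprD addrA -[X in `|X - _|]scale1r -scalerBl normrZ.
  by rewrite (le_trans _ xy)// ler_piMl// ger0_norm ?subr_ge0// gerBl.
rewrite ler_wpM2r// mulrCA ler_piMr ?(ltW e0)// ler_pdivrMr// mul1r.
by rewrite lerDl.
Qed.

Lemma C1_lift_shift f F x m : C1_lift f F -> Zn m -> Zn (F (x + m) - F x).
Proof. by move=> [_ Ff] Zm; apply/tpiP; rewrite !Ff tpiD. Qed.

Lemma Ck1_continuous F : Ck 1 F -> continuous F.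
Proof. by move=> [dF _] x; exact: differentiable_continuous. Qed.

Lemma near_shift0 (P : set 'rV[R]_n) (x : 'rV[R]_n) :
  (\forall y \near x, P y) -> \forall h \near (0 : 'rV[R]_n), P (x + h).
Proof.
move=> Px; have : (fun h : 'rV[R]_n => x + h) @ (0 : 'rV[R]_n) --> x.
  rewrite -[X in _ --> X]addr0.
  by apply: (@continuousD _ _ _ (cst x) id); [exact: cst_continuous|exact: cvg_id].
exact.
Qed.

Lemma C1_lift_diff_periodic f F x m :
  C1_lift f F -> Zn m -> 'd F (x + m) =1 'd F x.
Proof.
move=> lF Zm; have dF := lF.1.1.
apply: diff_eq_near => //.
have cF := Ck1_continuous lF.1.
have c1 : continuous (fun z : 'rV[R]_n => z + m).
  by move=> z; apply: (@continuousD _ _ _ id (cst m)); [exact: cvg_id|exact: cst_continuous].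
have c : continuous (fun z : 'rV[R]_n => F (z + m) - F z).
  exact: (fun z => continuousB (@continuous_comp _ _ _ _ F z (c1 z) (cF (z + m))) (cF z)).
have Z z : Zn (F (z + m) - F z) by exact: C1_lift_shift lF Zm.
have := near_shift0 (continuous_int_locally_constant c Z x).
apply: filterS => h /eqP; rewrite subr_eq => /eqP E.
by rewrite addrAC E [X in X - _]addrC addrAC addrA subrK.
Qed.

Lemma mulmx_ext p (A B : 'M[R]_(n, p)) :
  (forall v, v *m A = v *m B) -> A = B.
Proof. by move=> AB; apply/row_matrixP => i; rewrite !rowE. Qed.

Lemma C1_lift_jac_periodic f F x m :
  C1_lift f F -> Zn m -> 'J F (x + m) = 'J F x.
Proof.
move=> lF Zm.
have H (v : 'rV[R]_n) : v *m 'J F (x + m) = v *m 'J F x.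
  have E := C1_lift_diff_periodic x lF Zm v.
  exact: (etrans (esym (diff_mxE F (x + m) v)) (etrans E (diff_mxE F x v))).
exact: mulmx_ext H.
Qed.

(** The map [F' \o F] lifts the identity, so its displacement is a continuous lattice-valued
    function. *)
Lemma lift_cancel_near f f' F F' x : cancel f f' ->
  C1_lift f F -> C1_lift f' F' -> exists2 k, Zn k &
  \forall z \near x, F' (F z) = z + k.
Proof.
move=> ff' lF lF'; exists (F' (F x) - x).
  by apply/tpiP; rewrite lF'.2 lF.2 ff'.
have cF := Ck1_continuous lF.1; have cF' := Ck1_continuous lF'.1.
have c : continuous (fun z : 'rV[R]_n => F' (F z) - z).
  move=> z; have cz : {for z, continuous (F' \o F)}.
    exact: (continuous_comp (cF z) (cF' (F z))).
  exact: (continuousB cz (@cvg_id _ (nbhs z))).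
have Z z : Zn (F' (F z) - z) by apply/tpiP; rewrite lF'.2 lF.2 ff'.
have := continuous_int_locally_constant c Z x.
by apply: filterS => z <-; rewrite addrC subrK.
Qed.

Lemma lift_cancel_diff f f' F F' x v : cancel f f' ->
  C1_lift f F -> C1_lift f' F' -> 'd F' (F x) ('d F x v) = v.
Proof.
move=> ff' lF lF'; have dF := lF.1.1; have dF' := lF'.1.1.
have dFF' : differentiable (F' \o F) x by exact: differentiable_comp.
have E1 : 'd (F' \o F) x v = 'd F' (F x) ('d F x v).
  exact: (congr1 (fun u => u v) (diff_comp (dF x) (dF' (F x)))).
have E2 : 'd (@id 'rV[R]_n) x v = v.
  exact: (congr1 (fun u => u v) (@diff_val _ _ _ _ _ _ _ (is_diff_id x))).
suff E : 'd (F' \o F) x =1 'd (@id 'rV[R]_n) x.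
  exact: (etrans (esym E1) (etrans (E v) E2)).
apply: diff_eq_near => //.
have [k _ xk] := lift_cancel_near x ff' lF lF'.
have := near_shift0 xk; apply: filterS => h /= ->.
by have /= -> := nbhs_singleton xk; rewrite [x + h + k]addrAC [LHS]addrAC [RHS]addrAC !subrr !add0r.
Qed.

End Lifts.

(** * Boundedness and uniform continuity on the torus *)

Lemma comp_continuous (X Y Z : topologicalType) (u : X -> Y) (w : Y -> Z) :
  continuous u -> continuous w -> continuous (w \o u).
Proof. by move=> cu cw x A HA; exact: (cu x _ (cw _ _ HA)). Qed.

Lemma torus_bounded (R : realType) (n : nat) (W : normedModType R)
    (u : torus R n -> W) :
  continuous u -> exists2 C : R, 0 < C & forall p, `|u p| <= C.
Proof.
move=> cu.
have H : \forall C \near +oo, forall x, `|u (tpi x)| <= C.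
  apply: periodic_near => [C x m Zm|x]; first by rewrite tpiD.
  have cx : {for x, continuous (u \o @tpi R n)}.
    exact: (continuous_comp (@tpi_continuous R n x) (cu _)).
  have /cvgrPdist_le/(_ 1 ltr01) Hx := cx.
  exists ([set y | `|u (tpi x) - u (tpi y)| <= 1],
          [set C | `|u (tpi x)| + 1 <= C]) => /=.
    by split => //; exact: nbhs_pinfty_ge.
  move=> [y C] /= [xy]; apply: le_trans.
  rewrite -[X in `|X|](subrK (u (tpi x))) (le_trans (ler_normD _ _)) //.
  by rewrite addrC lerD2l distrC.
have [C [C0 HC]] : exists C : R, 0 < C /\ forall x, `|u (tpi x)| <= C.
  by near (pinfty_nbhs R) => C; exists C; split; near: C => //; exact: nbhs_pinfty_gt.
by exists C => // p; rewrite -(tpi_repr p).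
Unshelve. all: by end_near. Qed.

Lemma torus_unif_continuous (R : realType) (n : nat) (W : normedModType R)
    (u : torus R n -> W) : continuous u ->
  forall e : R, 0 < e -> exists2 r : R, 0 < r &
    forall x y : 'rV[R]_n, `|x - y| <= r -> `|u (tpi x) - u (tpi y)| <= e.
Proof.
move=> cu; apply: (@periodic_unif_continuous R n W (u \o @tpi R n)).
  by move=> x; exact: (continuous_comp (@tpi_continuous R n x) (cu _)).
by move=> x m Zm /=; rewrite tpiD.
Qed.

Lemma lipschitz_continuous (R : realType) (V W : normedModType R) (u : V -> W)
    (C : R) : (forall x y, `|u x - u y| <= C * `|x - y|) -> continuous u.
Proof.
move=> uC x; apply/cvgrPdist_le => e e0.
have C1 : 0 < `|C| + 1 by rewrite ltr_wpDl.
have eC : 0 < e / (`|C| + 1) by rewrite divr_gt0.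
near=> y; rewrite (le_trans (uC x y)) //.
rewrite (@le_trans _ _ ((`|C| + 1) * `|x - y|)) //.
  by rewrite ler_wpM2r // (le_trans (ler_norm _)) // lerDl.
by rewrite -ler_pdivlMl // mulrC; near: y; exact: cvgr_dist_le.
Unshelve. all: by end_near. Qed.

(** * Continuity of the projections of a splitting *)

Section Projections.
Variables (R : realType) (n : nat).
Implicit Types (U V W : {vspace 'rV[R]_n}) (v w : 'rV[R]_n).

(** The projection onto [U] along [V], acting on row vectors. In matrix form its continuity in the
    base point can be checked entrywise. *)
Definition vproj_mx U V : 'M[R]_n := lin1_mx (daddv_pi U V).

Lemma vproj_mxE U V v : v *m vproj_mx U V = daddv_pi U V v.
Proof. by rewrite mul_rV_lin1. Qed.

Lemma mem_vproj_mx U V v : v *m vproj_mx U V \in U.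
Proof. by rewrite vproj_mxE memv_pi. Qed.

Lemma vproj_mx_id U V v : (U :&: V = 0)%VS -> v \in U -> v *m vproj_mx U V = v.
Proof. by move=> UV vU; rewrite vproj_mxE daddv_pi_id. Qed.

Lemma vproj_mxC U V v : (U :&: V = 0)%VS -> (U + V = fullv)%VS ->
  v *m vproj_mx U V + v *m vproj_mx V U = v.
Proof. by move=> UV UVf; rewrite !vproj_mxE daddv_pi_add // UVf memvf. Qed.

Lemma vproj_mx0 U V v : (U :&: V = 0)%VS -> (U + V = fullv)%VS ->
  v \in V -> v *m vproj_mx U V = 0.
Proof.
move=> UV UVf vV; apply: (addIr (v *m vproj_mx V U)).
by rewrite vproj_mxC // add0r vproj_mx_id // capvC.
Qed.

Lemma directv3_capv U V W : directv (U + V + W) ->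
  (U :&: (V + W) = 0)%VS /\ (V :&: W = 0)%VS.
Proof.
rewrite directvE /= => /eqP E.
have [VW eVW] := dimv_add_leqif V W.
have [UVW eUVW] := dimv_add_leqif U (V + W).
rewrite -addvA in E; rewrite !subv0 in eVW eUVW.
by split; apply/eqP; [rewrite -eUVW|rewrite -eVW]; apply/eqP; move: VW UVW E; lia.
Qed.

Definition frame k (M : 'M[R]_(k, n)) U : Prop :=
  row_free M /\ forall v, v \in U <-> exists a : 'rV_k, v = a *m M.

(** A local frame stacked into one matrix, so that frames of two bundles are combined with
    [col_mx]. *)
Definition framed (E : torus R n -> {vspace 'rV[R]_n}) (p : torus R n) : Prop :=
  exists (k : nat) (M : torus R n -> 'M[R]_(k, n)),
  {for p, continuous M} /\ \forall q \near p, frame (M q) (E q).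

Lemma frame_add k1 k2 (M1 : 'M[R]_(k1, n)) (M2 : 'M[R]_(k2, n)) U V :
  frame M1 U -> frame M2 V -> (U :&: V = 0)%VS ->
  frame (col_mx M1 M2) (U + V).
Proof.
move=> [F1 m1] [F2 m2] UV; split.
  apply: inj_row_free => a; rewrite -[a]hsubmxK mul_row_col => /eqP.
  rewrite addr_eq0 => /eqP a12.
  have : lsubmx a *m M1 \in (U :&: V)%VS.
    rewrite memv_cap; apply/andP; split; first by apply/m1; exists (lsubmx a).
    by rewrite a12; apply/m2; exists (- rsubmx a); rewrite mulNmx.
  rewrite UV memv0 => /eqP a1; rewrite a1 in a12.
  have /eqP := esym a12; rewrite oppr_eq0 mulmx_free_eq0 // => /eqP ->.
  by move/eqP: a1; rewrite mulmx_free_eq0 // => /eqP ->; rewrite row_mx0.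
move=> v; split => [/memv_addP[v1 /m1[a1 ->] [v2 /m2[a2 ->] ->]]|[a ->]].
  by exists (row_mx a1 a2); rewrite mul_row_col.
rewrite -[a]hsubmxK mul_row_col; apply: memv_add.
  by apply/m1; exists (lsubmx a).
by apply/m2; exists (rsubmx a).
Qed.

Lemma frame_full k (M : 'M[R]_(k, n)) : frame M fullv -> row_full M.
Proof.
move=> [_ Mf]; rewrite -sub1mx; apply/row_subP => i.
have /Mf[a ->] := memvf (row i 1%:M : 'rV[R]_n).
exact: submxMl.
Qed.

Lemma subbundle_framed E p : subbundle E -> framed E p.
Proof.
move=> [k /(_ p) [X Xp]]; exists k, (fun q => \matrix_i X i q); split.
  apply: (@cvg_entries R _ (nbhs p)) => i j; rewrite mxE.
  under eq_fun do rewrite mxE.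
  apply: (@cvg_entry R _ (nbhs p)).
  by have [_ /(_ i)] := nbhs_singleton Xp.
apply: filterS Xp => q [bX _]; split.
  apply: inj_row_free => a; rewrite mulmx_sum_row => a0.
  have /freeP/(_ (fun i => a 0 i)) := basis_free bX.
  move=> F; apply/rowP => i; rewrite [RHS]mxE; apply: F.
  rewrite -[RHS]a0; apply: eq_bigr => j _.
  by rewrite rowK -tnth_nth tnth_mktuple.
move=> v; split => [vE|[a ->]].
  exists (\row_i coord [tuple X i q | i < k] i v).
  rewrite mulmx_sum_row {1}(coord_basis bX vE); apply: eq_bigr => j _.
  by rewrite rowK mxE -tnth_nth tnth_mktuple.
rewrite mulmx_sum_row; apply: memv_suml => j _; apply: memvZ.
rewrite rowK; apply: (basis_mem bX).
by apply/tnthP; exists j; rewrite tnth_mktuple.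
Qed.

Lemma cvg_col_mx (T : Type) (F : set_system T) {FF : Filter F} k1 k2
    (A : T -> 'M[R]_(k1, n)) (B : T -> 'M[R]_(k2, n)) A0 B0 :
  A x @[x --> F] --> A0 -> B x @[x --> F] --> B0 ->
  col_mx (A x) (B x) @[x --> F] --> (col_mx A0 B0 : 'M[R]_(k1 + k2, n)).
Proof.
move=> AA BB; apply: cvg_entries => i j.
case: (split_ordP i) => l ->.
  rewrite col_mxEu; under eq_fun do rewrite col_mxEu.
  exact: cvg_entry.
rewrite col_mxEd; under eq_fun do rewrite col_mxEd.
exact: cvg_entry.
Qed.

Lemma framed_add E1 E2 p : framed E1 p -> framed E2 p ->
  (forall q, (E1 q :&: E2 q = 0)%VS) -> framed (fun q => E1 q + E2 q)%VS p.
Proof.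
move=> [k1 [M1 [cM1 H1]]] [k2 [M2 [cM2 H2]]] E12.
exists (k1 + k2)%N, (fun q => col_mx (M1 q) (M2 q)); split.
  exact: (@cvg_col_mx _ (nbhs p)).
by apply: filterS2 H1 H2 => q H1 H2; exact: frame_add.
Qed.

(** Stacked frames have [k1 + k2] rows, a number equal to [n] only propositionally. The
    pseudo-inverse avoids a cast in the statement; after identifying [k] with [n] it is the inverse
    near the limit. *)
Lemma cvg_pinvmx (T : Type) (F : set_system T) {FF : Filter F} k
    (A : T -> 'M[R]_(k, n)) (A0 : 'M[R]_(k, n)) :
  row_free A0 -> row_full A0 ->
  A x @[x --> F] --> A0 -> pinvmx (A x) @[x --> F] --> pinvmx A0.
Proof.
move=> /eqP r1 /eqP r2; have kn : k = n := etrans (esym r1) r2.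
move: A A0 r1 r2; rewrite kn => A A0 _ r2 AA.
have uA0 : A0 \in unitmx by rewrite -row_full_unit /row_full r2.
have uA : \forall x \near F, A x \in unitmx.
  have dA0 : \det A0 != 0 by rewrite -unitfE -unitmxE.
  have dA : \det (A x) @[x --> F] --> \det A0 by exact: cvg_det.
  by have := @cvgr_neq0 R R T F FF _ _ dA dA0;
    apply: filterS => x; rewrite unitmxE unitfE.
have E : \forall x \near F, invmx (A x) = pinvmx (A x).
  by apply: filterS uA => x Ax; rewrite pinvmxE.
by rewrite pinvmxE //; apply: (cvg_trans (near_eq_cvg E)); exact: cvg_invmx.
Qed.

(** In a frame adapted to both bundles, the projection takes coordinates by the inverse of the
    stacked matrix and keeps only the block belonging to [E1]. Both factors are continuous. *)
Lemma vproj_mx_continuous (E1 E2 : torus R n -> {vspace 'rV[R]_n}) :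
  (forall p, framed E1 p) -> (forall p, framed E2 p) ->
  (forall p, (E1 p :&: E2 p = 0)%VS) -> (forall p, (E1 p + E2 p = fullv)%VS) ->
  continuous (fun p => vproj_mx (E1 p) (E2 p)).
Proof.
move=> fr1 fr2 E12 E12f p.
have [k1 [M1 [cM1 H1]]] := fr1 p; have [k2 [M2 [cM2 H2]]] := fr2 p.
have H : \forall q \near p, frame (col_mx (M1 q) (M2 q)) fullv.
  by apply: filterS2 H1 H2 => q H1 H2; rewrite -(E12f q); exact: frame_add.
have E : \forall q \near p, pinvmx (col_mx (M1 q) (M2 q)) *m col_mx (M1 q) 0 =
    vproj_mx (E1 q) (E2 q).
  apply: filterS3 H H1 H2 => q Hf [_ H1] [_ H2]; apply: mulmx_ext => v.
  have vE := mulmxKpV (submx_full v (frame_full Hf)).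
  rewrite -[in RHS]vE mulmxA; set a := v *m _.
  rewrite -[a]hsubmxK !mul_row_col mulmx0 addr0 mulmxDl.
  rewrite vproj_mx_id //; last by apply/H1; exists (lsubmx a).
  by rewrite vproj_mx0 ?addr0 //; apply/H2; exists (rsubmx a).
have /= Ep := nbhs_singleton E.
have Hp := nbhs_singleton H.
rewrite /continuous_at -Ep.
apply: (cvg_trans (near_eq_cvg E)).
apply: (@cvg_mulmx _ _ (nbhs p)).
  apply: (@cvg_pinvmx _ (nbhs p)); first exact: Hp.1.
    exact: frame_full.
  exact: (@cvg_col_mx _ (nbhs p)).
apply: (@cvg_col_mx _ (nbhs p)) => //.
exact: cst_continuous.
Qed.

End Projections.

(** * Riemannian metrics *)

Section Metric.
Variables (R : realType) (n : nat) (g : torus R n -> 'M[R]_n).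
Hypothesis Hg : riemannian_metric g.
Implicit Types (p : torus R n) (v w x : 'rV[R]_n).
Local Notation B := (metric_form g).
Local Notation N := (metric_norm g).

Lemma metric_formDl p v v' w : B p (v + v') w = B p v w + B p v' w.
Proof. by rewrite /metric_form !mulmxDl mxE. Qed.

Lemma metric_formZl p a v w : B p (a *: v) w = a * B p v w.
Proof. by rewrite /metric_form -!scalemxAl mxE. Qed.

Lemma metric_formC p v w : B p v w = B p w v.
Proof. by case: Hg => _ + _; apply. Qed.

Lemma metric_form_ge0 p v : 0 <= B p v v.
Proof.
have [->|v0] := eqVneq v 0; first by rewrite /metric_form !mul0mx mxE.
by apply: ltW; case: Hg => _ _; apply.
Qed.

Lemma metric_form_combine p a b v w : B p (a *: v + b *: w) (a *: v + b *: w) =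
  a ^+ 2 * B p v v + 2 * (a * b) * B p v w + b ^+ 2 * B p w w.
Proof.
rewrite !(metric_formDl, metric_formZl) ![B p _ (_ + _)]metric_formC.
rewrite !(metric_formDl, metric_formZl) [B p w v]metric_formC.
by ring.
Qed.

(** The form is nonnegative at [B p w w *: v - B p v w *: w], where its value is [B p w w] times the
    difference of the two sides. *)
Lemma metric_cauchy_schwarz p v w : B p v w ^+ 2 <= B p v v * B p w w.
Proof.
have [->|w0] := eqVneq w 0.
  by rewrite metric_formC /metric_form !mul0mx mxE mulr0 expr0n.
have c0 : 0 < B p w w by case: Hg => _ _; apply.
have := metric_form_ge0 p (B p w w *: v + (- B p v w) *: w).
rewrite metric_form_combine.
set a := B p v v; set b := B p v w; set c := B p w w.
have -> : c ^+ 2 * a + 2 * (c * - b) * b + (- b) ^+ 2 * c = c * (a * c - b ^+ 2).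
  by ring.
by rewrite pmulr_rge0 // subr_ge0.
Qed.

Lemma metric_normD p v w : N p (v + w) <= N p v + N p w.
Proof.
rewrite -[leRHS]ger0_norm ?addr_ge0 ?sqrtr_ge0 // -sqrtr_sqr.
apply: ler_wsqrtr; rewrite sqrrD !sqr_sqrtr ?metric_form_ge0 //.
have := metric_form_combine p 1 1 v w; rewrite !scale1r => ->.
rewrite !expr1n !mulr1 !mul1r.
rewrite -addrA -[leRHS]addrA lerD2l [leRHS]addrC [leRHS]addrC lerD2r.
rewrite -[leRHS]mulr_natl ler_wpM2l // -sqrtrM ?metric_form_ge0 //.
rewrite (le_trans (ler_norm _)) // -sqrtr_sqr.
by apply: ler_wsqrtr; exact: metric_cauchy_schwarz.
Qed.

Lemma metric_normZ p a v : N p (a *: v) = `|a| * N p v.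
Proof.
rewrite /metric_norm metric_formZl metric_formC metric_formZl mulrA -expr2.
by rewrite sqrtrM ?sqr_ge0 // sqrtr_sqr.
Qed.

Lemma metric_norm_ge0 p v : 0 <= N p v.
Proof. exact: sqrtr_ge0. Qed.

Lemma norm_trmx k l (M : 'M[R]_(k, l)) : `|M^T| <= `|M|.
Proof. by apply: norm_le_entries => // i j; rewrite mxE entry_le_norm. Qed.

Lemma norm_bilinear (M : 'M[R]_n) v w :
  `|(v *m M *m w^T) 0 0| <= n%:R ^+ 2 * `|M| * (`|v| * `|w|).
Proof.
rewrite (le_trans (entry_le_norm _ _ _)) // (le_trans (norm_mulmx _ _)) //.
rewrite (@le_trans _ _ (n%:R * (n%:R * `|v| * `|M|) * `|w|)) //.
  apply: ler_pM => //; rewrite ?norm_trmx ?mulr_ge0 //.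
  by rewrite ler_wpM2l // norm_mulmx.
by rewrite le_eqVlt; apply/orP; left; apply/eqP; ring.
Qed.

Lemma metric_continuous : continuous g.
Proof.
apply/quotient_continuous => x; apply: (@cvg_entries R _ (nbhs x)) => i j.
by case: Hg => /(_ i j 0%N)/(_ x).
Qed.

(** The constant is the minimum of the quadratic form on the unit sphere, which is compact;
    homogeneity extends the bound to all vectors. *)
Lemma metric_form_sphere p : exists2 c : R, 0 < c &
  forall v, c * `|v| ^+ 2 <= B p v v.
Proof.
pose S : set 'rV[R]_n := [set v | `|v| = 1].
have scale v : v != 0 -> S (`|v|^-1 *: v).
  by move=> v0; rewrite /S /= normrZ normfV normr_id mulVf // normr_eq0.
have [[v0 Sv0]|S0] := pselect (S !=set0); last first.
  exists 1 => // v; have [->|/scale Sv] := eqVneq v 0; last by case: S0; eexists; exact: Sv.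
  by rewrite normr0 expr0n mulr0 metric_form_ge0.
have cS : compact S.
  apply: bounded_closed_compact.
    by exists 1; split => // M M1 v /= ->; exact: ltW.
  have -> : S = Num.norm @^-1` [set (1 : R)] by [].
  apply: closed_comp; last exact: closed_eq.
  by move=> v _; exact: norm_continuous.
have cB : {within S, continuous (fun v => B p v v)}.
  apply: continuous_subspaceT => v.
  apply: (@cvg_entry R _ (nbhs v)); apply: (@cvg_mulmx R _ (nbhs v)).
    by apply: (@cvg_mulmx R _ (nbhs v)); [exact: cvg_id|exact: cst_continuous].
  apply: (@cvg_entries R _ (nbhs v)) => i j; rewrite mxE.
  by under eq_fun do rewrite mxE; apply: (@cvg_entry R _ (nbhs v)); exact: cvg_id.
have [v1 /set_mem Sv1 minv1] := EVT_min_rV (ex_intro _ v0 Sv0) cS cB.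
have v10 : v1 != 0 by apply: contra_eq_neq Sv1 => ->; rewrite normr0 eq_sym oner_neq0.
exists (B p v1 v1); first by case: Hg => _ _; apply.
move=> v; have [->|vn0] := eqVneq v 0.
  by rewrite normr0 expr0n mulr0 metric_form_ge0.
have := minv1 _ (mem_set (scale v vn0)).
rewrite metric_formZl metric_formC metric_formZl mulrA -expr2 exprVn.
by rewrite mulrC ler_pdivlMr // exprn_gt0 // normr_gt0.
Qed.

Lemma metric_norm_equiv : exists c C : R, [/\ 0 < c, 0 < C &
  forall p v, c * `|v| <= N p v <= C * `|v|].
Proof.
have [C C0 HC] := torus_bounded metric_continuous.
have [c c0 Hc] : exists2 c : R, 0 < c & forall x v, c * `|v| ^+ 2 <= B (tpi x) v v.
  have H : \forall c \near (0 : R)^'+, forall x v, c * `|v| ^+ 2 <= B (tpi x) v v.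
    apply: periodic_near => [c x m Zm|x]; first by rewrite tpiD.
    have [c c0 Hc] := metric_form_sphere (tpi x).
    (* Half of the constant at [x] still works at nearby points: the other half absorbs the
       variation of [g], whose effect on the form is at most [n%:R ^+ 2] times its norm. *)
    have d0 : 0 < n%:R ^+ 2 + 1 :> R by rewrite ltr_wpDl // sqr_ge0.
    have e0 : 0 < c / 2 / (n%:R ^+ 2 + 1) by rewrite !divr_gt0.
    have /cvgrPdist_le/(_ _ e0) Hx :=
      @comp_continuous _ _ _ (@tpi R n) g (@tpi_continuous R n) metric_continuous x.
    exists ([set y | `|g (tpi x) - g (tpi y)| <= c / 2 / (n%:R ^+ 2 + 1)],
            [set c' | c' < c / 2]) => /=.
      by split => //; apply: nbhs_right_lt; rewrite divr_gt0.
    move=> [y c'] /= [xy c'c] v.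
    have := norm_bilinear (g (tpi x) - g (tpi y)) v v.
    rewrite mulmxBr mulmxBl mxE [X in `|_ + X|]mxE -/(B _ _ _) -/(B _ _ _).
    move=> /(le_trans (ler_norm _)).
    have : n%:R ^+ 2 * `|g (tpi x) - g (tpi y)| <= c / 2.
      rewrite (le_trans (ler_wpM2l _ xy)) ?sqr_ge0 // mulrCA ler_piMr //.
        by rewrite divr_ge0 // ltW.
      by rewrite ler_pdivrMr // mul1r lerDl.
    have := Hc v; rewrite -!expr2; have := sqr_ge0 `|v|; move: c'c.
    move: (B (tpi x) v v) (B (tpi y) v v) (`|v| ^+ 2) (n%:R ^+ 2 * _).
    by move=> b b' s k; nra.
  have [c [c0 Hc]] : exists c : R, 0 < c /\ forall x v, c * `|v| ^+ 2 <= B (tpi x) v v.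
    by near (0 : R)^'+ => c; exists c; split; near: c => //; exact: nbhs_right_gt.
  by exists c.
exists (Num.sqrt c), (Num.sqrt (n%:R ^+ 2 * C + 1)); split; rewrite ?sqrtr_gt0 //.
  by rewrite ltr_wpDl // mulr_ge0 ?sqr_ge0 // ltW.
move=> p v; rewrite -(tpi_repr p); apply/andP; split.
  rewrite -[X in _ * X]normr_id -sqrtr_sqr -sqrtrM ?(ltW c0) //.
  exact: ler_wsqrtr.
rewrite -[X in _ * X]normr_id -sqrtr_sqr -sqrtrM; last first.
  by rewrite addr_ge0 // mulr_ge0 ?sqr_ge0 // ltW.
apply: ler_wsqrtr; rewrite (le_trans (ler_norm _)) //.
rewrite (le_trans (norm_bilinear _ _ _)) // -expr2 ler_wpM2r ?sqr_ge0 //.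
by rewrite (@le_trans _ _ (n%:R ^+ 2 * C)) ?lerDl // ler_wpM2l // sqr_ge0.
Unshelve. all: by end_near. Qed.

Lemma bundle_opnorm_lt1 F E : (bundle_opnorm g F E < 1)%E ->
  exists mu : R, [/\ 0 < mu, mu < 1 & forall x v, v \in E (tpi x) ->
    N (tpi (F x)) ('d F x v) <= mu * N (tpi x) v].
Proof.
move=> H1.
have [mu [mu0 mu1 Hmu]] : exists mu : R,
    [/\ 0 < mu, mu < 1 & (bundle_opnorm g F E <= mu%:E)%E].
  move: H1; case: (bundle_opnorm g F E) => [r|//|_] /=.
    (* The maximum with 1/2 keeps the contraction factor positive. The value [-oo] is the supremum
       of the empty set, and 1/2 serves there too. *)
    rewrite lte_fin => r1; exists (Num.max r 2^-1).
    by rewrite lt_max invr_gt0 ltr0n orbT gt_max r1 invf_lt1 ?ltr1n // lee_fin le_max lexx.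
  by exists 2^-1; split; rewrite ?invr_gt0 ?invf_lt1 ?ltr0n ?ltr1n ?leNye.
exists mu; split => // x v vE.
have [v0|v0] := eqVneq v 0.
  by rewrite v0 linear0 -(scale0r (0 : 'rV[R]_n)) !metric_normZ normr0 !mul0r mulr0.
have Nv : 0 < N (tpi x) v by rewrite sqrtr_gt0; case: Hg => _ _; apply.
have : ((N (tpi (F x)) ('d F x ((N (tpi x) v)^-1 *: v)))%:E <= mu%:E)%E.
  apply: le_trans Hmu; apply: ereal_sup_ubound.
  exists x, ((N (tpi x) v)^-1 *: v); split => //; first exact: memvZ.
  by rewrite metric_normZ gtr0_norm ?invr_gt0 // mulVf // gt_eqF.
rewrite lee_fin linearZ metric_normZ gtr0_norm ?invr_gt0 //.
by rewrite mulrC ler_pdivrMr.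
Qed.

End Metric.

(** * Contraction of distances to tangent sets *)

Section Contraction.
Variables (R : realType) (n : nat) (g : torus R n -> 'M[R]_n).
Variables (U V : torus R n -> {vspace 'rV[R]_n}).
Hypothesis Hg : riemannian_metric g.
Hypothesis UV0 : forall p, (U p :&: V p = 0)%VS.
Hypothesis UVf : forall p, (U p + V p = fullv)%VS.
Hypothesis Uframed : forall p, framed U p.
Hypothesis Vframed : forall p, framed V p.
Implicit Types (p : torus R n) (v w x y z q : 'rV[R]_n) (K : set 'rV[R]_n).

Local Notation PU := (fun p => vproj_mx (U p) (V p)).
Local Notation PV := (fun p => vproj_mx (V p) (U p)).
Local Notation N := (metric_norm g).

Let VU0 p : (V p :&: U p = 0)%VS. Proof. by rewrite capvC. Qed.
Let VUf p : (V p + U p = fullv)%VS. Proof. by rewrite addvC. Qed.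

Lemma PU_continuous : continuous PU.
Proof. exact: vproj_mx_continuous. Qed.

Lemma PV_continuous : continuous PV.
Proof. exact: vproj_mx_continuous. Qed.

(** On [U] this is the metric norm, for which the derivative contracts. As a sum over the two
    components, it drops whenever the [V] component alone shrinks, which drives the closest point
    argument. *)
Definition split_norm p v : R := N p (v *m PU p) + `|v *m PV p|.

Lemma split_normD p v w : split_norm p (v + w) <= split_norm p v + split_norm p w.
Proof.
rewrite /split_norm !mulmxDl addrACA lerD //; first exact: metric_normD.
exact: ler_normD.
Qed.

Lemma split_normZ p a v : split_norm p (a *: v) = `|a| * split_norm p v.
Proof. by rewrite /split_norm -!scalemxAl metric_normZ // normrZ mulrDr. Qed.

Lemma split_normN p v : split_norm p (- v) = split_norm p v.
Proof. by rewrite -scaleN1r split_normZ normrN1 mul1r. Qed.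

Lemma split_norm_equiv : exists c C : R, [/\ 0 < c, 0 < C &
  forall p v, c * `|v| <= split_norm p v <= C * `|v|].
Proof.
have [c [C [c0 C0 HN]]] := metric_norm_equiv Hg.
have [A A0 HA] := torus_bounded PU_continuous.
have [A' A'0 HA'] := torus_bounded PV_continuous.
have m0 : 0 < Num.min c 1 by rewrite lt_min c0 ltr01.
exists (Num.min c 1), (C * (n%:R * A) + n%:R * A' + 1); split => //.
  by rewrite ltr_wpDl // addr_ge0 // ?mulr_ge0 // ltW.
move=> p v; apply/andP; split.
  rewrite -[v in leLHS](vproj_mxC v (UV0 p) (UVf p)).
  rewrite (le_trans (ler_wpM2l (ltW m0) (ler_normD _ _))) // mulrDr lerD //.
    have /andP[H _] := HN p (v *m PU p); apply: le_trans H.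
    by rewrite ler_wpM2r // ge_min lexx.
  by rewrite ler_piMl // ge_min lexx orbT.
rewrite mulrDl mulrDl /split_norm -addrA lerD //.
  have /andP[_ H] := HN p (v *m PU p); apply: (le_trans H).
  rewrite -mulrA ler_wpM2l ?(ltW C0) // (le_trans (norm_mulmx _ _)) //.
  by rewrite -!mulrA ler_wpM2l // mulrC ler_wpM2r.
rewrite (@le_trans _ _ (n%:R * A' * `|v|)) ?lerDl ?mul1r //.
rewrite (le_trans (norm_mulmx _ _)) //.
by rewrite -!mulrA ler_wpM2l // mulrC ler_wpM2r.
Qed.

(** Every vector of [E] at a point of [K] belongs to the contingent (Bouligand) cone of [K] there.
    This one-sided first-order condition is all that is used of the submanifold in the contraction
    argument. *)
Definition tangent_set (E : torus R n -> {vspace 'rV[R]_n}) K : Prop :=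
  forall q v, K q -> v \in E (tpi q) -> forall e : R, 0 < e ->
  exists t y, [/\ 0 < t, t <= e, K y & `|y - q - t *: v| <= e * t].

Lemma split_norm_lipschitz C p v w : (forall u, split_norm p u <= C * `|u|) ->
  `|split_norm p v - split_norm p w| <= C * `|v - w|.
Proof.
move=> HC; have := split_normD p (v - w) w; have := split_normD p (w - v) v.
rewrite !subrK; have := HC (v - w); have := HC (w - v); rewrite distrC => H1 H2 H3 H4.
by rewrite ler_norml; apply/andP; split; lra.
Qed.

(** Let [q'] minimize the split norm of [z - y] over [y] in [K]. If [z - q'] had a nonzero [V]
    component [w], moving from [q'] inside [K] in a direction close to [w] would decrease this norm.
    The radius depends neither on [K] nor on [z]. *)
Lemma closest_point : exists2 r : R, 0 < r & forall K z q,
  closed K -> tangent_set V K -> K q -> split_norm (tpi z) (z - q) <= r ->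
  exists q', [/\ K q', split_norm (tpi z) (z - q') <= split_norm (tpi z) (z - q) &
    z - q' \in U (tpi z)].
Proof.
have [c [C [c0 C0 HC]]] := split_norm_equiv.
have HCu p v : split_norm p v <= C * `|v| by have /andP[] := HC p v.
have HCl p v : c * `|v| <= split_norm p v by have /andP[] := HC p v.
(* With this modulus for the projections, replacing [w] by its projection to [V] at [q'] costs at
   most a quarter of [|w|] in the split norm. *)
have e0 : 0 < (4 * C * (n%:R + 1))^-1.
  by rewrite invr_gt0 !mulr_gt0 // ltr_wpDl.
have [r r0 Hr] := torus_unif_continuous PV_continuous e0.
exists (c * r); first exact: mulr_gt0.
move=> K z q Kcl Ktan Kq zq.
pose S : set 'rV[R]_n := K `&` [set y | split_norm (tpi z) (z - y) <= split_norm (tpi z) (z - q)].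
have Sbound y : S y -> `|z - y| <= r.
  by move=> [_ /= zy]; rewrite -(ler_pM2l c0); exact: le_trans (HCl (tpi z) _) (le_trans zy zq).
have cN : continuous (fun y => split_norm (tpi z) (z - y)).
  apply: (@lipschitz_continuous _ _ _ _ C) => y y'.
  rewrite (le_trans (split_norm_lipschitz _ _ (HCu (tpi z)))) //.
  rewrite (_ : z - y - (z - y') = y' - y) 1?distrC //.
  by apply/rowP => i; rewrite !mxE; ring.
have cS : compact S.
  apply: bounded_closed_compact.
    exists (`|z| + r); split; first exact: num_real.
    move=> M rM y /Sbound zy; apply: le_trans (ltW rM).
    by rewrite -[y in leLHS](subKr z) (le_trans (ler_normB _ _)) // lerD2l.
  apply: closedI => //.
  apply: (@closed_comp _ _ (fun y => split_norm (tpi z) (z - y)) [set x | x <= _]).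
    by move=> y _; exact: cN.
  exact: closed_le.
have [|q' /set_mem[Kq' q'q] minq'] := EVT_min_rV _ cS (continuous_subspaceT cN).
  by exists q; split => //=.
exists q'; split => //.
set d := z - q'; set w := d *m PV (tpi z).
have dE : d *m PU (tpi z) + w = d by rewrite vproj_mxC.
suff w0 : w = 0 by rewrite -dE w0 addr0 mem_vproj_mx.
apply/eqP; apply/negPn/negP => wn0.
have wpos : 0 < `|w| by rewrite normr_gt0.
(* The vector [w] lies in [V] at [z], whereas tangency of [K] at [q'] concerns [V] at [q']; hence
   the projection. *)
pose v := w *m PV (tpi q').
have wV : w \in V (tpi z) by exact: mem_vproj_mx.
have vw : C * `|v - w| <= `|w| / 4.
  have -> : v - w = w *m (PV (tpi q') - PV (tpi z)).
    by rewrite mulmxBr [w *m PV (tpi z)]vproj_mx_id.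
  have : `|PV (tpi q') - PV (tpi z)| <= (4 * C * (n%:R + 1))^-1.
    by apply: Hr; rewrite distrC; apply: Sbound.
  move=> Pr; rewrite (le_trans (ler_wpM2l (ltW C0) (norm_mulmx _ _))) //.
  rewrite (@le_trans _ _ (C * (n%:R * `|w| * (4 * C * (n%:R + 1))^-1))) //.
    by rewrite ler_wpM2l ?(ltW C0) // ler_wpM2l // mulr_ge0.
  have -> : C * (n%:R * `|w| * (4 * C * (n%:R + 1))^-1) =
      `|w| / 4 * (n%:R / (n%:R + 1)).
    by field; rewrite (gt_eqF C0) gt_eqF // ltr_wpDl.
  by rewrite ler_piMr ?divr_ge0 // ler_pdivrMr ?ltr_wpDl // mul1r lerDl.
(* The tangency error then also costs at most a quarter of [t * |w|], and [t <= 1] keeps the factor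
   [1 - t] of the remaining [V] component nonnegative. *)
pose e := Num.min 1 (`|w| / (4 * C)).
have epos : 0 < e by rewrite lt_min ltr01 divr_gt0 // mulr_gt0.
have Ce : C * e <= `|w| / 4.
  rewrite (@le_trans _ _ (C * (`|w| / (4 * C)))) //.
    by rewrite ler_wpM2l ?(ltW C0) // ge_min lexx orbT.
  by rewrite le_eqVlt; apply/orP; left; apply/eqP; field; rewrite gt_eqF.
have [t [y [t0 te Ky ytv]]] := Ktan q' v Kq' (mem_vproj_mx _ _ _) e epos.
have t1 : t <= 1 by rewrite (le_trans te) // ge_min lexx.
(* Subtracting [t *: w] gains exactly [t * |w|], since only the [V] component changes. The two
   errors together take back at most half of it. *)
have small : split_norm (tpi z) (z - y) < split_norm (tpi z) d.
  have -> : z - y = (d - t *: w) + (- (t *: (v - w)) - (y - q' - t *: v)).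
    rewrite /d scalerBr; move: (t *: v) (t *: w) => a b.
    by apply/rowP => i; rewrite !mxE; ring.
  rewrite (le_lt_trans (split_normD _ _ _)) //.
  have -> : split_norm (tpi z) (d - t *: w) = split_norm (tpi z) d - t * `|w|.
    rewrite /split_norm !(mulmxBl d) -!scalemxAl (vproj_mx0 (UV0 _) (UVf _) wV) scaler0 subr0.
    rewrite -/w [w *m PV (tpi z)]vproj_mx_id // -addrA; congr (_ + _).
    rewrite -[X in `|X - _|]scale1r -scalerBl normrZ ger0_norm ?subr_ge0 //.
    by rewrite mulrBl mul1r.
  have := split_normD (tpi z) (- (t *: (v - w))) (- (y - q' - t *: v)).
  rewrite !split_normN split_normZ (gtr0_norm t0).
  have := HCu (tpi z) (v - w); have := HCu (tpi z) (y - q' - t *: v).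
  move: vw Ce ytv wpos t0 C0.
  move: (split_norm _ (v - w)) (split_norm _ (y - q' - t *: v)) => s1 s2.
  move: (split_norm _ _) (split_norm _ d) => s3 s4.
  move: `|v - w| `|y - _ - _| `|w| => a b k.
  move=> H1 H2 H3 H4 H5 H6 H7 H8 H9.
  have H10 : C * b <= C * (e * t) by rewrite ler_wpM2l // ltW.
  have H11 : C * (e * t) <= k / 4 * t by rewrite mulrA ler_wpM2r // ltW.
  have H12 : t * s1 <= t * (k / 4) by rewrite ler_wpM2l ?(ltW H5) // (le_trans H8).
  have : 0 < k * t by rewrite mulr_gt0.
  nra.
have : split_norm (tpi z) d <= split_norm (tpi z) (z - y).
  by apply: minq'; apply/mem_set; split => //=; rewrite (le_trans (ltW small)).
by rewrite leNgt small.
Qed.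

Variables (f : torus R n -> torus R n) (F : 'rV[R]_n -> 'rV[R]_n) (mu : R).
Hypothesis lF : C1_lift f F.
Hypothesis FU : invariant_bundle F U.
Hypothesis mu0 : 0 < mu.
Hypothesis mu1 : mu < 1.
Hypothesis Fmu : forall x v, v \in U (tpi x) ->
  N (tpi (F x)) ('d F x v) <= mu * N (tpi x) v.

(** Passing to the closest point puts [z - q'] in [U], where the derivative contracts by [mu]. The
    linearization error uses half of the gap [1 - mu], which leaves the rate [(1 + mu) / 2]. *)
Lemma contraction_step : exists r nu : R, [/\ 0 < r, 0 <= nu < 1 & forall K z q,
  closed K -> tangent_set V K -> K q -> split_norm (tpi z) (z - q) <= r ->
  exists2 q', K q' & split_norm (tpi (F z)) (F z - F q') <=
    nu * split_norm (tpi z) (z - q)].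
Proof.
have [c [C [c0 C0 HC]]] := split_norm_equiv.
have HCu p v : split_norm p v <= C * `|v| by have /andP[] := HC p v.
have HCl p v : c * `|v| <= split_norm p v by have /andP[] := HC p v.
have [m1 m2] : 0 <= (1 + mu) / 2 /\ 0 <= (1 - mu) / 2.
  by split; move: mu0 mu1; move: mu => m; lra.
have [r1 r10 Hclose] := closest_point.
(* The ratio [c / C] pays for passing from the split norm to the ambient norm and back. *)
have e0 : 0 < (1 - mu) / 2 * (c / C) by rewrite !mulr_gt0 // ?invr_gt0 ?subr_gt0.
have [r2 r20 Hdiff] := C1_unif_differentiable lF.1
  (fun x m => C1_lift_jac_periodic x lF) e0.
exists (Num.min r1 (c * r2)), ((1 + mu) / 2); split.
- by rewrite lt_min r10 mulr_gt0.
- by apply/andP; split; move: mu0 mu1; move: mu => m; lra.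
move=> K z q Kcl Ktan Kq zq.
have [|q' [Kq' q'q dU]] := Hclose K z q Kcl Ktan Kq.
  by rewrite (le_trans zq) // ge_min lexx.
exists q' => //; set d := z - q' in q'q dU *.
have dr2 : `|d| <= r2.
  rewrite -(ler_pM2l c0) (le_trans (HCl (tpi z) _)) // (le_trans q'q) //.
  by rewrite (le_trans zq) // ge_min lexx orbT.
have Nd : split_norm (tpi z) d = N (tpi z) d.
  by rewrite /split_norm vproj_mx_id // vproj_mx0 // normr0 addr0.
have dFU : 'd F z d \in U (tpi (F z)).
  have := memv_img (linfun ('d F z)) dU; rewrite FU lfunE.
  exact.
have NdF : split_norm (tpi (F z)) ('d F z d) = N (tpi (F z)) ('d F z d).
  by rewrite /split_norm vproj_mx_id // vproj_mx0 // normr0 addr0.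
apply: (@le_trans _ _ ((1 + mu) / 2 * N (tpi z) d)); last first.
  by rewrite -Nd ler_wpM2l.
rewrite -[F z - F q'](subrK ('d F z d)) (le_trans (split_normD _ _ _)) //.
have H1 : split_norm (tpi (F z)) (F z - F q' - 'd F z d) <= (1 - mu) / 2 * N (tpi z) d.
  rewrite (le_trans (HCu _ _)) //.
  rewrite (le_trans (ler_wpM2l (ltW C0) (Hdiff z q' dr2))) // -Nd.
  have := HCl (tpi z) d; rewrite -/d.
  have -> : C * ((1 - mu) / 2 * (c / C) * `|d|) = (1 - mu) / 2 * (c * `|d|).
    by field; rewrite gt_eqF.
  exact: ler_wpM2l.
have H2 := Fmu dU; rewrite NdF.
rewrite (le_trans (lerD H1 H2)) // -mulrDl.
by rewrite (_ : (1 - mu) / 2 + mu = (1 + mu) / 2) //; field.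
Qed.

(** Each step applies the contraction to a preimage of [T] under one iterate fewer, until a point of
    [T] itself is reached. The distance only decreases, so it stays within the admissible radius. *)
Lemma iter_contraction : exists r nu : R, [/\ 0 < r, 0 <= nu < 1 &
  forall T : set (torus R n),
  (forall k, closed [set x | T (iter k f (tpi x))]) ->
  (forall k, tangent_set V [set x | T (iter k f (tpi x))]) ->
  forall k x q s, T (iter k f (tpi q)) -> split_norm (tpi x) (x - q) <= s -> s <= r ->
  exists2 q', T (tpi q') &
    split_norm (tpi (iter k F x)) (iter k F x - q') <= nu ^+ k * s].
Proof.
have [r [nu [r0 /andP[nu0 nu1] H]]] := contraction_step.
exists r, nu; split => //; first by rewrite nu0.
move=> T Tcl Ttan; elim=> [|k IH] x q s Tq xq sr.
  by exists q => //; rewrite expr0 mul1r.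
have [q' Tq' q'F] := H _ x q (Tcl k.+1) (Ttan k.+1) Tq (le_trans xq sr).
have Fs : split_norm (tpi (F x)) (F x - F q') <= nu * s.
  by rewrite (le_trans q'F) // ler_wpM2l.
have [||y Ty yF] := IH (F x) (F q') (nu * s) _ Fs.
- by rewrite lF.2 -iterSr.
- rewrite (le_trans _ sr) // ler_piMl // ?(ltW nu1) //.
  by rewrite (le_trans _ xq) // addr_ge0 // metric_norm_ge0.
by exists y => //; rewrite iterSr exprSr -mulrA.
Qed.

End Contraction.

(** * Compact tangent submanifolds *)

Lemma C1_lift_continuous (R : realType) (n : nat) (f : torus R n -> torus R n)
    (F : 'rV[R]_n -> 'rV[R]_n) : C1_lift f F -> continuous f.
Proof.
move=> lF; apply/quotient_continuous => x.
have -> : f \o \pi_(torus R n)%qT = @tpi R n \o F.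
  by apply/funext => y; rewrite /= lF.2.
apply: (@comp_continuous _ _ _ F (@tpi R n)); last exact: tpi_continuous.
exact: Ck1_continuous lF.1.
Qed.

Lemma diff_near_line (R : realType) (V W : normedModType R) (F : V -> W) x v
    (e : R) : differentiable F x -> 0 < e ->
  exists2 r : R, 0 < r & forall t, 0 < t -> t <= r ->
    `|F (x + t *: v) - F x - t *: 'd F x v| <= e * t.
Proof.
move=> dF e0.
have v1 : 0 < `|v| + 1 by rewrite ltr_wpDl.
have e1 : 0 < e / (`|v| + 1) by rewrite divr_gt0.
have /nbhs_ballP[r r0 Hr] := diff_near dF e1.
exists (r / (`|v| + 1) / 2) => [|t t0 tr]; first by rewrite !divr_gt0.
have /Hr /= : ball (0 : V) r (t *: v).
  rewrite -ball_normE /= sub0r normrN normrZ (gtr0_norm t0).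
  rewrite (@le_lt_trans _ _ (t * (`|v| + 1))) //; first by rewrite ler_wpM2l ?(ltW t0) // lerDl.
  rewrite -ltr_pdivlMr // (le_lt_trans tr) // ltr_pdivrMr // ltr_pMr ?ltr1n //.
  by rewrite divr_gt0.
rewrite linearZ /= => /le_trans; apply.
rewrite normrZ (gtr0_norm t0).
have -> : e / (`|v| + 1) * (t * `|v|) = e * t * (`|v| / (`|v| + 1)).
  by field; rewrite gt_eqF.
by rewrite ler_piMr ?mulr_ge0 ?(ltW e0) ?(ltW t0) // ler_pdivrMr // mul1r lerDl.
Qed.

Section Immersions.
Variables (R : realType) (n d : nat) (S : topologicalType) (i : S -> torus R n).
Variables (E : torus R n -> {vspace 'rV[R]_n}) (T : set (torus R n)).
Hypothesis iT : tangent_immersion d i E T.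

(** Near [s] the map [i] is [tpi \o H] read through the open embedding [h]. *)
Lemma tangent_immersion_continuous : continuous i.
Proof.
case: iT => _ _ _ _ charts s A iA.
have [h [H [[ch ih oh] [u _ us] [CH _] Hi _]]] := charts s.
have cH : continuous H by move=> z; exact: differentiable_continuous.
have hu : nbhs u [set u' | A (i (h u'))].
  have := @comp_continuous _ _ _ H (@tpi R n) cH (@tpi_continuous R n) u.
  rewrite /continuous_at /=.
  rewrite Hi us => /(_ _ iA) iAu.
  by apply: (@filterS _ (nbhs u) _ _ _ _ iAu) => u' /=; rewrite Hi.
suff : nbhs s (i @^-1` A) by [].
rewrite nbhsE; exists (h @` [set u' | A (i (h u'))]^°) => /=.
  split; first by apply: oh; exact: open_interior.
  by exists u.
by move=> _ [u' /interior_subset u'A <-].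
Qed.

Lemma tangent_immersion_closed : compact [set: S] -> closed T.
Proof.
move=> cS; case: (iT) => _ _ _ <- _.
apply: compact_closed; first exact: torus_hausdorff.
apply: continuous_compact => //.
by apply: continuous_subspaceT; exact: tangent_immersion_continuous.
Qed.

Lemma tangent_immersion_tangent_set : tangent_set E [set x | T (tpi x)].
Proof.
case: iT => _ _ _ iE charts q v /= Tq vE e e0.
move: Tq; rewrite -iE => -[s _ sq].
have [h [H [_ [u _ us] [CH _] Hi dH]]] := charts s.
have Huq : tpi (H u) = tpi q by rewrite Hi us.
have /tpiP Zm : tpi q = tpi (H u) by [].
(* The chart lift [H u] and the given lift [q] of the same point differ by a lattice vector, and the
   curve in the chart is translated by it. *)
set m := q - H u in Zm.
have [_ limE] := dH u.
have /memv_imgP[xi _ vxi] : v \in limg (linfun ('d H u)) by rewrite limE Huq.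
rewrite lfunE /= in vxi.
have [r r0 Hr] := diff_near_line xi (CH u) e0.
exists (Num.min e r), (H (u + Num.min e r *: xi) + m); split.
- by rewrite lt_min e0.
- by rewrite ge_min lexx.
- by exists (h (u + Num.min e r *: xi)) => //; rewrite tpiD // Hi.
have := Hr (Num.min e r); rewrite lt_min e0 r0 ge_min lexx orbT => /(_ isT isT).
rewrite -vxi /m; apply: le_trans; rewrite le_eqVlt; apply/orP; left; apply/eqP.
by congr `|_ - _|; rewrite addrCA addrC addrK.
Qed.

(** By compactness, all points of [T] near [tpi 0] come from a single small chart, so no other sheet
    accumulates there. That chart is nearly parallel to [E] and misses the points displaced in a
    direction [e] of [U]. *)
Lemma tangent_immersion_neq_setT (U : {vspace 'rV[R]_n}) :
  compact [set: S] -> U != 0%VS -> (U :&: E (tpi 0) = 0)%VS ->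
  (U + E (tpi 0) = fullv)%VS -> T != setT.
Proof.
move=> cS U0 UE0 UEf; apply/eqP => TT.
case: (iT) => _ _ inji iE charts.
have [s _ sp] : range i (tpi 0) by rewrite iE TT.
have [h [H [[ch ih oh] [u0 _ us] CH Hi dH]]] := charts s.
have Hu0 : tpi (H u0) = tpi 0 by rewrite Hi us.
have [J0 JE] := dH u0; rewrite Hu0 in JE.
pose e := vpick U; have eU : e \in U by exact: memv_pick.
have en0 : e != 0 by rewrite vpick0.
have e_gt0 : 0 < `|e| by rewrite normr_gt0.
set J := 'J H u0.
have Jfree : row_free J.
  apply: inj_row_free => w wJ.
  have : w \in lker (linfun ('d H u0)).
    by rewrite memv_ker lfunE /=; apply/eqP; rewrite diff_mxE.
  by rewrite (eqP J0) memv0 => /eqP.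
pose c := (n%:R * `|pinvmx J| + 1)^-1.
have c0 : 0 < c by rewrite invr_gt0 ltr_wpDl // mulr_ge0.
have Jc (w : 'rV[R]_d) : c * `|w| <= `|w *m J|.
  rewrite -[w in leLHS]mulmx1 -(mulmxVp Jfree) mulmxA mulrC.
  rewrite ler_pdivrMr ?ltr_wpDl ?mulr_ge0 //.
  by rewrite (le_trans (norm_mulmx _ _)) // mulrDr mulr1 -mulrA mulrCA lerDl.
pose P := vproj_mx U (E (tpi 0)).
have eP : e *m P = e by exact: vproj_mx_id.
have JP (w : 'rV[R]_d) : w *m J *m P = 0.
  apply: vproj_mx0 => //; rewrite -JE -diff_mxE.
  by have := memv_img (linfun ('d H u0)) (memvf w); rewrite lfunE.
pose k := n%:R * `|P|; have k0 : 0 <= k by rewrite mulr_ge0.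
have k1 : 0 < k + 1 by rewrite ltr_wpDl.
pose eps := c / (4 * (k + 1)).
have eps0 : 0 < eps by rewrite divr_gt0 // mulr_gt0.
have cH : continuous H by move=> z; exact: differentiable_continuous (CH.1 z).
(* The first condition makes the chart nearly linear. The second excludes nonzero lattice
   translations when lifts are compared below. *)
pose B := [set u | `|H u - H u0 - (u - u0) *m J| <= eps * `|u - u0| /\
                   `|H u0 - H u| <= 2^-1].
have nB : nbhs u0 B.
  have h20 : 0 < 2^-1 :> R by rewrite invr_gt0.
  have /cvgrPdist_le/(_ _ h20) H1 := cH u0.
  have H2 : nbhs u0 [set u | `|H u - H u0 - (u - u0) *m J| <= eps * `|u - u0|].
    have cu : continuous (fun u : 'rV[R]_d => u - u0).
      apply: (@lipschitz_continuous _ _ _ _ 1) => x y.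
      by rewrite mul1r opprB addrA subrK.
    have := cu u0; rewrite /continuous_at subrr => /(_ _ (diff_near (CH.1 u0) eps0)).
    move=> H2; apply: (@filterS _ (nbhs u0) _ _ _ _ H2) => u /=.
    by rewrite subrKC diff_mxE.
  by apply: (@filterS2 _ (nbhs u0) _ _ _ _ _ H2 H1) => u; split.
pose C := ~` (h @` B°).
have sC : ~ C s by apply; exists u0 => //; exact: nbhs_singleton (nbhs_interior nB).
have clC : closed C by apply: open_closedC; apply: oh; exact: open_interior.
have cliC : closed (i @` C).
  apply: compact_closed; first exact: torus_hausdorff.
  apply: continuous_compact.
    by apply: continuous_subspaceT; exact: tangent_immersion_continuous.
  by rewrite -(setTI C); exact: compact_closedI.
have niC : nbhs (tpi 0) (~` (i @` C)).
  apply: open_nbhs_nbhs; split; first exact: closed_openC.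
  by move=> [s' Cs' s'p]; apply: sC; rewrite (inji s s') // sp s'p.
have cl : continuous (fun t : R => H u0 + t *: e).
  apply: (@lipschitz_continuous _ _ _ _ `|e|) => x y.
  by rewrite opprD addrACA subrr add0r -scalerBl normrZ mulrC.
have : nbhs (0 : R) [set t | (~` (i @` C)) (tpi (H u0 + t *: e))].
  have := @comp_continuous _ _ _ _ (@tpi R n) cl (@tpi_continuous R n) (0 : R).
  rewrite /continuous_at /=.
  by rewrite scale0r addr0 Hu0 => /(_ _ niC).
move=> /nbhs_ballP[r /= r0 Hr].
pose t := Num.min (r / 2) (2^-1 / (2 * `|e|)).
have t0 : 0 < t by rewrite lt_min !divr_gt0 ?mulr_gt0 ?invr_gt0.
have te : t * `|e| <= 4^-1.
  have : t <= 2^-1 / (2 * `|e|) by rewrite ge_min lexx orbT.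
  move=> /(ler_wpM2r (ltW e_gt0))/le_trans; apply.
  by rewrite le_eqVlt; apply/orP; left; apply/eqP; field; rewrite gt_eqF.
have /Hr /= tC : ball (0 : R) r t.
  rewrite -ball_normE /= sub0r normrN gtr0_norm // gt_min.
  by rewrite ltr_pdivrMr // ltr_pMr // ltr1n.
have [s' _ s't] : range i (tpi (H u0 + t *: e)) by rewrite iE TT.
have [u Bu us'] : (h @` B°) s'.
  by apply: contrapT => Cs'; apply: tC; exists s'.
have [Bu1 Bu2] := interior_subset Bu.
have Hu : H u = H u0 + t *: e.
  apply/eqP; rewrite -subr_eq0; apply/eqP; apply: int_lattice_lt1.
    by apply/tpiP; rewrite Hi us' s't.
  rewrite opprD addrA (le_lt_trans (ler_normB _ _)) // normrZ gtr0_norm //.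
  rewrite distrC (le_lt_trans (lerD Bu2 te)) //.
  lra.
rewrite Hu [H u0 + _]addrC addrK in Bu1; set w := u - u0 in Bu1.
have teN : `|t *: e| = t * `|e| by rewrite normrZ gtr0_norm.
(* [H1] bounds [w] through the injectivity of [J]; [H2] bounds the displacement through the
   projection [P], which kills the image of [J]. Together with the choice of [eps] they give
   [c * |w| <= c * |w| / 2], which forces [t * |e| <= 0]. *)
have H1 : c * `|w| <= t * `|e| + eps * `|w|.
  rewrite (le_trans (Jc w)) // -teN.
  rewrite -[w *m J](subKr (t *: e)) (le_trans (ler_normB _ _)) //.
  by rewrite lerD2l.
have H2 : t * `|e| <= k * (eps * `|w|).
  rewrite -teN; have -> : t *: e = (t *: e - w *m J) *m P.
    by rewrite mulmxBl JP subr0 -scalemxAl eP.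
  by rewrite (le_trans (norm_mulmx _ _)) // /k mulrAC ler_wpM2l // mulr_ge0.
have H3 : k * eps <= c / 4.
  have -> : k * eps = c / 4 * (k / (k + 1)) by rewrite /eps; field; rewrite gt_eqF.
  by rewrite ler_piMr ?divr_ge0 ?(ltW c0) // ler_pdivrMr // mul1r lerDl.
have H4 : eps <= c / 4.
  rewrite /eps ler_pdivrMr ?mulr_gt0 // mulrA divfK // ler_peMr ?(ltW c0) //.
  by rewrite lerDr.
have H5 : 0 < t * `|e| by rewrite mulr_gt0.
have H6 : k * (eps * `|w|) <= c / 4 * `|w| by rewrite mulrA ler_wpM2r.
have H7 : eps * `|w| <= c / 4 * `|w| by rewrite ler_wpM2r.
move: H1 H2 H5 H6 H7; rewrite [c / 4 * _]mulrAC.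
move: (c * `|w|) (t * `|e|) (eps * `|w|) => x y z; move: (k * z) => x'.
lra.
Qed.

End Immersions.

(** * Tangent sets under preimages by the diffeomorphism *)

Section Preimages.
Variables (R : realType) (n : nat) (f f' : torus R n -> torus R n).
Variables (F F' : 'rV[R]_n -> 'rV[R]_n) (E : torus R n -> {vspace 'rV[R]_n}).
Hypothesis ff' : cancel f f'.
Hypothesis f'f : cancel f' f.
Hypothesis lF : C1_lift f F.
Hypothesis lF' : C1_lift f' F'.
Hypothesis FE : invariant_bundle F E.

(** The direction [v] is pushed forward by the derivative of [F], [T] is followed in that direction
    from [F q], and the resulting point is brought back by [F'], whose derivative inverts that of
    [F]. *)
Lemma tangent_set_preimage (T : set (torus R n)) :
  tangent_set E [set x | T (tpi x)] -> tangent_set E [set x | T (f (tpi x))].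
Proof.
move=> TE q v /= Tq vE e e0.
have dF' := lF'.1.1.
have dvE : 'd F q v \in E (tpi (F q)).
  have := memv_img (linfun ('d F q)) vE; rewrite FE lfunE.
  exact.
set w := 'd F q v in dvE.
pose M := `|w| + 1; have M0 : 0 < M by rewrite ltr_wpDl.
pose L := n%:R * `|'J F' (F q)| + 1; have L0 : 0 < L by rewrite ltr_wpDl // mulr_ge0.
have e1 : 0 < e / (2 * M) by rewrite divr_gt0 // mulr_gt0.
have /nbhs_ballP[r r0 Hr] := diff_near (dF' (F q)) e1.
(* The bounds ensure in turn: the required smallness of [t], the estimate of [y - F q] by [t * M],
   that [y] lies where [F'] is well linearized, and that the tangency error transported by [F']
   stays below [e / 2 * t]. *)
pose a := Num.min (Num.min e 1) (Num.min (r / (2 * M)) (e / (2 * L))).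
have a0 : 0 < a by rewrite !lt_min e0 ltr01 !divr_gt0 // mulr_gt0.
have [ae a1 ar aL] : [/\ a <= e, a <= 1, a <= r / (2 * M) & a <= e / (2 * L)].
  by split; rewrite /a !ge_min lexx ?orbT.
have [|t [y [t0 ta Ty ytw]]] := TE (F q) w _ dvE a a0; first by rewrite /= lF.2.
have [k Zk xk] := lift_cancel_near q ff' lF lF'.
have /= F'Fq := nbhs_singleton xk.
exists t, (F' y - k); split => //; first exact: le_trans ta ae.
  by rewrite /= (tpiD _ (int_latticeN Zk)) lF'.2 f'f.
have yFq : `|y - F q| <= t * M.
  rewrite -(subrK (t *: w) (y - F q)) (le_trans (ler_normD _ _)) //.
  rewrite normrZ (gtr0_norm t0) mulrDr mulr1 addrC lerD2l (le_trans ytw) //.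
  by rewrite ler_piMl // ltW.
have yr : ball (0 : 'rV[R]_n) r (y - F q).
  rewrite -ball_normE /= sub0r normrN (le_lt_trans yFq) //.
  rewrite (@le_lt_trans _ _ (r / 2)) ?ltr_pdivrMr ?ltr_pMr ?ltr1n //.
  rewrite -ler_pdivlMr // (le_trans ta) // (le_trans ar) //.
  by rewrite invfM mulrA.
have H1 := Hr _ yr; rewrite /= subrKC in H1.
have H2 : 'd F' (F q) (y - F q - t *: w) = 'd F' (F q) (y - F q) - t *: v.
  rewrite linearB linearZ /=; congr (_ - _ *: _).
  exact: lift_cancel_diff ff' lF lF'.
have H3 : `|'d F' (F q) (y - F q - t *: w)| <= e / 2 * t.
  rewrite diff_mxE (le_trans (norm_mulmx _ _)) //.
  rewrite (@le_trans _ _ (L * (a * t))) //.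
    by rewrite mulrAC ler_pM ?mulr_ge0 // /L lerDl.
  rewrite mulrA ler_wpM2r ?(ltW t0) // (le_trans (ler_wpM2l (ltW L0) aL)) //.
  by rewrite le_eqVlt; apply/orP; left; apply/eqP; field; rewrite gt_eqF.
have -> : F' y - k - q - t *: v =
    (F' y - F' (F q) - 'd F' (F q) (y - F q)) + 'd F' (F q) (y - F q - t *: w).
  rewrite H2 F'Fq; move: ('d F' _ _) (t *: v) (F' y) => b1 b2 b3.
  by apply/rowP => j; rewrite !mxE; ring.
rewrite (le_trans (ler_normD _ _)) // [e in leRHS]splitr mulrDl lerD //.
rewrite (le_trans H1) // (le_trans (ler_wpM2l (ltW e1) yFq)) //.
by rewrite le_eqVlt; apply/orP; left; apply/eqP; field; rewrite gt_eqF.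
Qed.

Lemma tangent_set_iter (T : set (torus R n)) k :
  tangent_set E [set x | T (tpi x)] -> tangent_set E [set x | T (iter k f (tpi x))].
Proof.
elim: k T => [//|k IH] T TE.
have := tangent_set_preimage (T := [set p | T (iter k f p)]) (IH T TE).
move=> H q v /= Tq vE e e0.
have [|t [y [t0 te Ty ytv]]] := H q v _ vE e e0; first by rewrite /= -iterSr.
by exists t, y; split => //; rewrite -iterS iterSr.
Qed.

Lemma closed_iter (T : set (torus R n)) k :
  closed T -> closed [set x | T (iter k f (tpi x))].
Proof.
move=> clT; have ck : continuous (iter k f).
  elim: k => [|k IH] p; first exact: cvg_id.
  apply: (@comp_continuous _ _ _ (iter k f) f) => //; exact: C1_lift_continuous lF.
apply: (@closed_comp _ _ (fun x => iter k f (tpi x)) T) => // x _.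
exact: (@comp_continuous _ _ _ (@tpi R n) (iter k f) (@tpi_continuous R n) ck x).
Qed.

End Preimages.

(** * Linear partially hyperbolic maps *)

Lemma exists_expr_le (R : realType) (a e : R) : 0 <= a < 1 -> 0 < e ->
  exists k : nat, a ^+ k <= e.
Proof.
move=> /andP[a0 a1] e0.
have /cvgrPdist_le/(_ e e0) : (fun k => a ^+ k) @ \oo --> 0.
  by apply: cvg_expr; rewrite ger0_norm.
by case=> k _ /(_ k (leqnn k)); rewrite sub0r normrN ger0_norm ?exprn_ge0 //; exists k.
Qed.

Lemma closed_approx (R : realType) (V : normedModType R) (K : set V) x :
  closed K -> (forall e : R, 0 < e -> exists2 y, K y & `|x - y| <= e) -> K x.
Proof.
move=> clK H; apply: clK => A /nbhs_ballP[e /= e0 eA].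
have e20 : 0 < e / 2 by rewrite divr_gt0.
have [y Ky xy] := H _ e20; exists y; split => //; apply: eA.
by rewrite -ball_normE /= (le_lt_trans xy) // ltr_pdivrMr // ltr_pMr // ltr1n.
Qed.

Section ToralMap.
Variables (R : realType) (n : nat).
Implicit Types (v w x m : 'rV[R]_n) (V : {vspace 'rV[R]_n}) (B : 'M[R]_n).
Local Notation Zn := (@int_lattice R n).
Local Notation mulpow B k := (iter k (fun w : 'rV[R]_n => w *m B)).

Lemma mulpowB B k v w : mulpow B k (v - w) = mulpow B k v - mulpow B k w.
Proof. by elim: k => //= k ->; rewrite mulmxBl. Qed.

Lemma mulpow_mem B V k v : (forall w, w \in V -> w *m B \in V) ->
  v \in V -> mulpow B k v \in V.
Proof. by move=> VB vV; elim: k => //= k; exact: VB. Qed.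

Lemma mulpowKV B k v : B \in unitmx -> mulpow B k (mulpow (invmx B) k v) = v.
Proof.
move=> uB; elim: k v => //= k IH v.
rewrite (_ : iter k _ _ *m B = iter k.+1 (fun w : 'rV[R]_n => w *m B)
  (iter k (fun w : 'rV[R]_n => w *m invmx B) v *m invmx B)) //.
by rewrite iterSr mulmxKV.
Qed.

Lemma mulpow_eq0 B k v : B \in unitmx -> mulpow B k v = 0 -> v = 0.
Proof.
move=> uB; elim: k => //= k IH /(congr1 (fun w => w *m invmx B)).
by rewrite mulmxK // mul0mx.
Qed.

(** The metric norm is taken at moving base points, so the factors [mu] multiply exactly. Comparison
    with the fixed norm is made only at the two ends and costs the constant [C / c] once. *)
Lemma norm_mulpow_le f F g B V mu : C1_lift f F -> riemannian_metric g ->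
  (forall x v, 'd F x v = v *m B) ->
  (forall v, v \in V -> v *m B \in V) -> 0 <= mu ->
  (forall x v, v \in V ->
    metric_norm g (tpi (F x)) ('d F x v) <= mu * metric_norm g (tpi x) v) ->
  exists2 C : R, 0 < C & forall k v, v \in V -> `|mulpow B k v| <= C * mu ^+ k * `|v|.
Proof.
move=> lF Hg dF VB mu0 Fmu.
have [c [C [c0 C0 HC]]] := metric_norm_equiv Hg.
exists (C / c) => [|k v vV]; first exact: divr_gt0.
have H : metric_norm g (tpi (iter k F 0)) (mulpow B k v) <=
    mu ^+ k * metric_norm g (tpi 0) v.
  elim: k => [|k IH]; first by rewrite expr0 mul1r.
  have H := Fmu (iter k F 0) _ (mulpow_mem k VB vV).
  have E := dF (iter k F 0) (mulpow B k v).
  apply: (le_trans (eq_ind _ (fun u => metric_norm g _ u <= _) H _ E)).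
  by rewrite exprS -mulrA ler_wpM2l.
have /andP[H1 _] := HC (tpi (iter k F 0)) (mulpow B k v).
have /andP[_ H2] := HC (tpi 0) v.
rewrite -(ler_pM2l c0) (le_trans H1) // (le_trans H) //.
have -> : c * (C / c * mu ^+ k * `|v|) = mu ^+ k * (C * `|v|).
  by field; rewrite gt_eqF.
by rewrite ler_wpM2l // exprn_ge0.
Qed.

Variable A : 'M[int]_n.
Local Notation AR := (map_mx (intr : int -> R) A).

Lemma int_lattice_mul m : Zn m -> Zn (m *m AR).
Proof.
move=> /mxOverP Zm; apply/mxOverP => i j; rewrite mxE.
by apply: rpred_sum => k _; rewrite rpredM // mxE intr_int.
Qed.

Lemma int_lattice_mulpow k m : Zn m -> Zn (mulpow AR k m).
Proof. by move=> Zm; elim: k => //= k; exact: int_lattice_mul. Qed.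

Lemma toral_map_tpi x : toral_map A (tpi x) = tpi (x *m AR).
Proof.
rewrite /toral_map; have [m Zm ->] := repr_tpi x.
by rewrite mulmxDl tpiD //; exact: int_lattice_mul.
Qed.

(** A lift differs from the linear map by a continuous lattice-valued function, which is locally
    constant. *)
Lemma diff_toral_lift F x v : C1_lift (toral_map A) F -> 'd F x v = v *m AR.
Proof.
move=> lF.
pose L : {linear 'rV[R]_n -> 'rV[R]_n} := mulmxr AR.
have cL : continuous L.
  apply: (@lipschitz_continuous _ _ _ _ (n%:R * `|AR|)) => y z.
  by rewrite /= -mulmxBl (le_trans (norm_mulmx _ _)) // mulrAC.
have -> : v *m AR = 'd L x v.
  exact: (congr1 (fun u => u v) (esym (diff_lin x cL))).
apply: diff_eq_near; first exact: lF.1.1; first exact: linear_differentiable.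
have cF := Ck1_continuous lF.1.
have c : continuous (fun z : 'rV[R]_n => F z - L z).
  by move=> z; exact: (@continuousB _ _ _ F L z (cF z) (cL z)).
have Z z : Zn (F z - L z) by apply/tpiP; rewrite lF.2 toral_map_tpi.
have := near_shift0 (continuous_int_locally_constant c Z x).
apply: filterS => h /= /eqP; rewrite subr_eq => /eqP ->.
by rewrite mulmxDl; move: (F x) (x *m _) (h *m _) => a b e;
  apply/rowP => i; rewrite !mxE; ring.
Qed.

Variables (Vs Vc Vu : {vspace 'rV[R]_n}).
Hypothesis phA : partially_hyperbolic (toral_map A)
  (fun=> Vs) (fun=> Vc) (fun=> Vu).

Lemma toral_unitmx : AR \in unitmx.
Proof.
have [_ [_ [f' [F [F' [[ff' f'f lF lF'] _]]]]]] := phA.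
rewrite -row_free_unit; apply: inj_row_free => v vA.
have E := diff_toral_lift 0 v lF; rewrite vA in E.
have E' := lift_cancel_diff 0 v ff' lF lF'.
exact: (etrans (esym E') (etrans (congr1 _ E) (linear0 _))).
Qed.

Lemma toral_image_mem F V v : C1_lift (toral_map A) F ->
  invariant_bundle F (fun=> V) -> v \in V -> v *m AR \in V.
Proof.
move=> lF /(_ 0) FV vV; have := memv_img (linfun ('d F 0)) vV.
rewrite FV lfunE => H.
exact: (eq_ind _ (fun w => w \in V) H _ (diff_toral_lift 0 v lF)).
Qed.

Lemma toral_preimage_mem F V v : C1_lift (toral_map A) F ->
  invariant_bundle F (fun=> V) -> v \in V -> v *m invmx AR \in V.
Proof.
move=> lF /(_ 0) FV; rewrite -[in v \in V]FV => /memv_imgP[w wV ->].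
rewrite lfunE; have E := diff_toral_lift 0 w lF.
apply: (eq_ind_r (fun u => u *m invmx AR \in V) _ E).
by rewrite mulmxK // toral_unitmx.
Qed.

Lemma toral_center_mem v : v \in Vc -> v *m AR \in Vc.
Proof.
have [_ [_ [f' [F [F' [[ff' f'f lF lF'] [[_ Fc _] _]]]]]]] := phA.
exact: (toral_image_mem lF Fc).
Qed.

Lemma toral_unstable_inv v : v \in Vu -> v *m invmx AR \in Vu.
Proof.
have [_ [_ [f' [F [F' [[ff' f'f lF lF'] [[_ _ Fu] _]]]]]]] := phA.
exact: (toral_preimage_mem lF Fu).
Qed.

Lemma toral_unstable_bounded : exists2 C : R, 0 < C &
  forall k v, v \in Vu -> `|mulpow (invmx AR) k v| <= C * `|v|.
Proof.
have [_ [_ [f' [F [F' [[ff' f'f lF lF'] [[_ _ Fu] [g [Hg [_ Hu _]]]]]]]]]] := phA.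
have [mu [mu0 mu1 Hmu]] := bundle_opnorm_lt1 Hg Hu.
have dF' x v : 'd F' x v = v *m invmx AR.
  have E := diff_toral_lift (F' x) ('d F' x v) lF.
  have E' := etrans (esym E) (lift_cancel_diff x v f'f lF' lF).
  exact: (etrans (esym (mulmxK toral_unitmx _)) (congr1 (fun w => w *m invmx AR) E')).
have [C C0 HC] := norm_mulpow_le lF' Hg dF' toral_unstable_inv (ltW mu0) Hmu.
exists C => // k v vu; rewrite (le_trans (HC k v vu)) // ler_wpM2r //.
by rewrite ler_piMr ?(ltW C0) // exprn_ile1 // ltW.
Qed.

Lemma toral_stable_contracts v e : v \in Vs -> 0 < e ->
  exists k, `|mulpow AR k v| <= e.
Proof.
move=> vs e0.
have [_ [_ [f' [F [F' [[ff' f'f lF lF'] [[Fs _ _] [g [Hg [Hs _ _]]]]]]]]]] := phA.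
have [mu [mu0 mu1 Hmu]] := bundle_opnorm_lt1 Hg Hs.
have dF x w : 'd F x w = w *m AR by exact: diff_toral_lift.
have VsA w : w \in Vs -> w *m AR \in Vs by exact: (toral_image_mem lF Fs).
have [C C0 HC] := norm_mulpow_le lF Hg dF VsA (ltW mu0) Hmu.
have v1 : 0 < `|v| + 1 by rewrite ltr_wpDl.
have [||k Hk] := @exists_expr_le R mu (e / (C * (`|v| + 1))).
- by rewrite ltW.
- by rewrite divr_gt0 // mulr_gt0.
exists k; rewrite (le_trans (HC k v vs)) //.
rewrite (@le_trans _ _ (C * mu ^+ k * (`|v| + 1))) //.
  by rewrite ler_wpM2l ?lerDl // mulr_ge0 ?exprn_ge0 // ltW.
by rewrite mulrAC mulrC -ler_pdivlMr // mulr_gt0.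
Qed.

(** Some lattice vector has a nonzero stable component. Powers of the automorphism make this
    component arbitrarily small without annihilating it, and integer multiples of it then
    approximate any point of the stable line. *)
Lemma toral_cu_dense w e : \dim Vs = 1%N -> 0 < e ->
  exists m v, [/\ Zn m, v \in (Vc + Vu)%VS & `|w - m - v| <= e].
Proof.
move=> dim1 e0.
have [[_ spl] [ne0 [f' [F [F' [[ff' f'f lF lF'] [[Fs Fc Fu] _]]]]]]] := phA.
have [dir full] := spl (tpi 0).
have [scu0 _] := directv3_capv dir; rewrite -addvA in full.
pose P := vproj_mx Vs (Vc + Vu).
have PA x : x *m AR *m P = x *m P *m AR.
  rewrite -[in LHS](vproj_mxC x scu0 full) !mulmxDl.
  rewrite [X in X + _]vproj_mx_id //; last first.
    by apply: (toral_image_mem lF Fs); exact: mem_vproj_mx.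
  rewrite [X in _ + X]vproj_mx0 ?addr0 //.
  have /memv_addP[vc vcV [vu vuV ->]] := mem_vproj_mx (Vc + Vu) Vs x.
  rewrite mulmxDl memv_add //; first exact: (toral_image_mem lF Fc).
  exact: (toral_image_mem lF Fu).
have PpowA k x : mulpow AR k x *m P = mulpow AR k (x *m P).
  by elim: k => //= k IH; rewrite PA IH.
(* Otherwise the stable projection would vanish on the standard basis, although it is the identity
   on the nonzero space [Vs]. *)
have [j mP] : exists j, (delta_mx 0 j : 'rV[R]_n) *m P != 0.
  apply: contrapT => nomP.
  have P0 : P = 0.
    apply/row_matrixP => j; rewrite rowE row0; apply/eqP/negPn/negP => jP.
    by apply: nomP; exists j.
  have [s0 _ _] := ne0 (tpi 0).
  have /eqP := vpick0 Vs; rewrite (negbTE s0) => /eqP; apply/negP; rewrite negbK.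
  by rewrite -(vproj_mx_id scu0 (memv_pick Vs)) -/P P0 mulmx0.
pose m0 : 'rV[R]_n := delta_mx 0 j.
have Zm0 : Zn m0.
  by apply/mxOverP => i l; rewrite mxE rpred_nat.
have [k Hk] := toral_stable_contracts (mem_vproj_mx Vs (Vc + Vu) m0) e0.
pose a := mulpow AR k m0 *m P.
have aE : a = mulpow AR k (m0 *m P) by rewrite /a PpowA.
have an0 : a != 0.
  by apply: contra_neq mP => a0; apply: (mulpow_eq0 (k := k) toral_unitmx); rewrite -aE.
have aVs : a \in Vs by exact: mem_vproj_mx.
have VsE : Vs = <[a]>%VS.
  by apply/esym/eqP; rewrite eqEdim -memvE aVs dim1 dim_vline an0.
have /vlineP[c wc] : w *m P \in <[a]>%VS by rewrite -VsE mem_vproj_mx.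
(* Subtracting [q] copies of the lattice vector leaves the stable component [(c - q) *: a] with
   [0 <= c - q <= 1], no longer than [a]. *)
pose q := (Num.floor c)%:~R : R.
exists (q *: mulpow AR k m0), ((w - q *: mulpow AR k m0) *m vproj_mx (Vc + Vu) Vs).
split.
- have /mxOverP Zk := int_lattice_mulpow k Zm0.
  by apply/mxOverP => i l; rewrite mxE rpredM // intr_int.
- exact: mem_vproj_mx.
set y := w - _.
have -> : y - y *m vproj_mx (Vc + Vu) Vs = (c - q) *: a.
  rewrite -{1}(vproj_mxC y scu0 full) addrK -/P /y mulmxBl wc -scalemxAl -/a.
  by rewrite scalerBl.
rewrite normrZ aE (le_trans _ Hk) // ler_piMl // ger0_norm ?subr_ge0 ?floor_le //.
by rewrite lerBlDl; have := floorD1_gt c; rewrite intrD => /ltW.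
Qed.

End ToralMap.

(** * Propagation along center-unstable leaves *)

(** The torus carries only a topology here, so closeness of images is expressed by a pair of close
    lifts. *)
Lemma torus_map_unif_continuous (R : realType) (n : nat)
    (u : torus R n -> torus R n) (e : R) : continuous u -> 0 < e ->
  exists2 r : R, 0 < r & forall x y : 'rV[R]_n, `|x - y| <= r ->
    exists a b : 'rV[R]_n, [/\ tpi a = u (tpi x), tpi b = u (tpi y) & `|a - b| <= e].
Proof.
move=> cu e0; apply: periodic_lebesgue_number.
  by move=> x y m Zm; rewrite !tpiD.
move=> x0; pose a0 : 'rV[R]_n := repr (u (tpi x0)).
have e20 : 0 < e / 2 by rewrite divr_gt0.
have c : continuous (u \o @tpi R n) by exact: comp_continuous (@tpi_continuous R n) cu.
have := nbhs_tpi (nbhsx_ballx a0 _ e20); rewrite tpi_repr => /(c x0) U.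
exists [set x | (@tpi R n @` ball a0 (e / 2)) (u (tpi x))] => //= x y.
move=> [a xa <-] [b yb <-]; exists a, b; split => //.
rewrite -ball_normE /= in xa yb; rewrite -(subrKA a0) (le_trans (ler_normD _ _)) //.
by rewrite [leRHS]splitr lerD // ltW // distrC.
Qed.

Lemma iter_lift (R : realType) (n : nat) (f : torus R n -> torus R n)
    (F : 'rV[R]_n -> 'rV[R]_n) k x :
  C1_lift f F -> tpi (iter k F x) = iter k f (tpi x).
Proof. by move=> lF; elim: k => //= k IH; rewrite lF.2 IH. Qed.

Lemma iter_cancel (X : Type) (u u' : X -> X) k :
  cancel u' u -> cancel (iter k u') (iter k u).
Proof.
move=> u'u; elim: k => // k IH p.
by rewrite [iter k.+1 u _]iterSr [iter k.+1 u' _]iterS u'u IH.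
Qed.

Section LeafConjugacy.
Variables (R : realType) (n : nat) (f : torus R n -> torus R n).
Variables (A : 'M[int]_n) (Vs Vc Vu : {vspace 'rV[R]_n}).
Variables (psi psi' : torus R n -> torus R n).
Hypothesis phA : partially_hyperbolic (toral_map A)
  (fun=> Vs) (fun=> Vc) (fun=> Vu).
Hypothesis psiK : cancel psi psi'.
Hypothesis psi'K : cancel psi' psi.
Hypothesis psi'_continuous : continuous psi'.
Implicit Types (a b c v w x y : 'rV[R]_n).
Local Notation AR := (map_mx (intr : int -> R) A).
Local Notation mulpow B k := (iter k (fun w : 'rV[R]_n => w *m B)).

(** The pointwise content of the leaf conjugacy: the conjugated map agrees with the linear one up to
    a displacement along the center leaf. *)
Hypothesis psi_f : forall a, exists2 c, c \in Vc &
  psi (f (psi' (tpi a))) = tpi (a *m AR + c).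

Lemma psi_iter k a : exists2 c, c \in Vc &
  psi (iter k f (psi' (tpi a))) = tpi (mulpow AR k a + c).
Proof.
elim: k => [|k [c cV IH]]; first by exists 0; rewrite ?mem0v // psi'K addr0.
have [c' c'V E] := psi_f (mulpow AR k a + c).
exists (c *m AR + c'); first by rewrite memvD // (toral_center_mem phA).
by rewrite iterS -[iter k f _]psiK IH E mulmxDl -addrA.
Qed.

Variable f' : torus R n -> torus R n.
Hypothesis f'f : cancel f' f.
Variables (T : set (torus R n)).
Hypothesis shadow : exists2 r : R, 0 < r & forall z : torus R n,
  (forall k, exists x y : 'rV[R]_n,
    [/\ iter k f (tpi x) = z, T (iter k f (tpi y)) & `|x - y| <= r]) -> T z.

(** Displacing the [k]-th backward iterate by the pulled back vector [vk] yields a point whose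
    [k]-th image lies on the leaf through [b], hence in [T]. Backward iteration does not expand [Vu]
    beyond a fixed constant, so the displacement is small uniformly in [k] and shadowing applies. *)
Lemma center_leaf_step : exists2 d : R, 0 < d & forall b v,
  v \in Vu -> `|v| <= d ->
  (forall c, c \in Vc -> T (psi' (tpi (b + c)))) ->
  forall c, c \in Vc -> T (psi' (tpi (b + v + c))).
Proof.
have [r r0 Hr] := shadow.
have [d d0 Hd] := torus_map_unif_continuous psi'_continuous r0.
have [C C0 HC] := toral_unstable_bounded phA.
exists (d / C) => [|b v vV vd Tb c cV]; first exact: divr_gt0.
apply: Hr => k; set z := psi' _.
pose a : 'rV[R]_n := repr (psi (iter k f' z)).
have aE : psi' (tpi a) = iter k f' z by rewrite tpi_repr psiK.
pose vk := mulpow (invmx AR) k v.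
have [|x [y [xE yE xy]]] := Hd a (a - vk).
  by rewrite subKr (le_trans (HC k v vV)) // mulrC -ler_pdivlMr.
exists x, y; split => //; first by rewrite xE aE (iter_cancel k f'f).
have [c1 c1V E1] := psi_iter k a; rewrite aE (iter_cancel k f'f) psi'K in E1.
have [c2 c2V E2] := psi_iter k (a - vk).
rewrite yE -[iter k f _]psiK E2 mulpowB mulpowKV ?(toral_unitmx phA) //.
have /tpiP Zm := E1; set m := b + v + c - _ in Zm.
(* The unknown center displacements [c1] and [c2] only move the point along the leaf of [b], which
   is wholly covered by the assumption on [b]. *)
have -> : tpi (mulpow AR k a - v + c2) = tpi (b + (c - c1 + c2)).
  apply/tpiP.
  suff -> : mulpow AR k a - v + c2 - (b + (c - c1 + c2)) = - m.
    exact: int_latticeN.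
  by rewrite /m; move: (iter _ _ _) => u; apply/rowP => i; rewrite !mxE; ring.
by apply: Tb; rewrite memvD // memvB.
Qed.

(** The admissible step [d] does not depend on the leaf, so a vector of [Vu] is cut into [J] equal
    pieces of length at most [d], which are added one after the other. *)
Lemma center_unstable_leaf b :
  (forall c, c \in Vc -> T (psi' (tpi (b + c)))) ->
  forall u, u \in (Vc + Vu)%VS -> T (psi' (tpi (b + u))).
Proof.
move=> Tb u /memv_addP[c cV [v vV ->]].
have [d d0 Hd] := center_leaf_step.
pose J := (Num.trunc (`|v| / d)).+1.
have J0 : 0 < J%:R :> R by rewrite ltr0n.
have vJ : `|J%:R^-1 *: v| <= d.
  rewrite normrZ ger0_norm ?invr_ge0 ?(ltW J0) // mulrC ler_pdivrMr // mulrC.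
  by rewrite -ler_pdivrMr // ltW // truncnS_gt.
have H j : forall c, c \in Vc -> T (psi' (tpi (b + j%:R *: (J%:R^-1 *: v) + c))).
  elim: j => [|j IH]; first by rewrite scale0r addr0.
  have := Hd _ _ (memvZ _ vV) vJ IH.
  by rewrite -addrA -[X in _ + (_ + X)]scale1r -scalerDl -natr1.
by have := H J c cV; rewrite scalerA mulfV ?gt_eqF // scale1r -addrA [v + c]addrC.
Qed.

Lemma center_leaf_dense b : closed T -> \dim Vs = 1%N ->
  (forall c, c \in Vc -> T (psi' (tpi (b + c)))) -> T = setT.
Proof.
move=> clT dim1 Tb; apply/seteqP; split => // p _.
rewrite -(psiK p) -(tpi_repr (psi p)); move: (repr _ : 'rV[R]_n) => w.
have clK : closed [set x : 'rV[R]_n | T (psi' (tpi x))].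
  apply: (@closed_comp _ _ (psi' \o @tpi R n) T) => // x _.
  exact: (@comp_continuous _ _ _ (@tpi R n) psi' (@tpi_continuous R n)).
apply: (closed_approx clK) => e e0.
have [m [v [Zm vV wmv]]] := toral_cu_dense phA (w - b) dim1 e0.
exists (b + v + m); first by rewrite /= tpiD //; exact: center_unstable_leaf.
by rewrite (_ : w - (b + v + m) = w - b - m - v) //; apply/rowP => i; rewrite !mxE; ring.
Qed.

End LeafConjugacy.

(** * Shadowing and conclusion *)

(** The [k]-th preimage of [z] lies within the contraction radius of the [k]-th preimage of [T], so
    [z] is at distance of order [nu ^+ k] from [T]. Letting [k] grow, closedness puts [z] in [T]. *)
Lemma shadowing (R : realType) (n : nat) (f : torus R n -> torus R n)
    (Es Ec Eu : torus R n -> {vspace 'rV[R]_n}) (T : set (torus R n)) :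
  partially_hyperbolic f Es Ec Eu -> closed T ->
  tangent_set (fun p => Ec p + Eu p)%VS [set x | T (tpi x)] ->
  exists2 r : R, 0 < r & forall z : torus R n,
  (forall k, exists x y : 'rV[R]_n,
    [/\ iter k f (tpi x) = z, T (iter k f (tpi y)) & `|x - y| <= r]) -> T z.
Proof.
move=> [[[fs fc fu] spl] [ne0 [f' [F [F' [[ff' f'f lF lF'] [[Fs Fc Fu] [g [Hg [Hs _ _]]]]]]]]]].
move=> clT tanT.
have scu0 p : (Es p :&: (Ec p + Eu p) = 0)%VS.
  by have [dir _] := spl p; have [] := directv3_capv dir.
have cu0 p : (Ec p :&: Eu p = 0)%VS.
  by have [dir _] := spl p; have [] := directv3_capv dir.
have full p : (Es p + (Ec p + Eu p) = fullv)%VS.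
  by have [_ E] := spl p; rewrite addvA.
have frs p : framed Es p by exact: subbundle_framed.
have frcu p : framed (fun q => Ec q + Eu q)%VS p.
  by apply: framed_add => //; exact: subbundle_framed.
have Fcu : invariant_bundle F (fun q => Ec q + Eu q)%VS.
  by move=> x; rewrite limgD Fc Fu.
have [mu [mu0 mu1 Hmu]] := bundle_opnorm_lt1 Hg Hs.
have [r [nu [r0 nu01 Hit]]] := iter_contraction Hg scu0 full frs frcu lF Fs mu0 mu1 Hmu.
have [c [C [c0 C0 HC]]] := split_norm_equiv Hg scu0 full frs frcu.
exists (r / C) => [|z Hz]; first exact: divr_gt0.
rewrite -(tpi_repr z); set x : 'rV[R]_n := repr z.
apply: (closed_approx (closed_iter lF (k := 0) clT)) => e e0 /=.
have [k Hk] : exists k, nu ^+ k <= c * e / r.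
  by apply: exists_expr_le => //; rewrite divr_gt0 // mulr_gt0.
have [y [q [yz Tq yq]]] := Hz k.
have yqr : split_norm g Es (fun q => Ec q + Eu q)%VS (tpi y) (y - q) <= r.
  have /andP[_ H] := HC (tpi y) (y - q); rewrite (le_trans H) //.
  by rewrite mulrC -ler_pdivlMr.
have [q' Tq' Hq'] := Hit T (fun k => closed_iter lF clT)
  (fun k => tangent_set_iter ff' f'f lF lF' Fcu tanT) k y q r Tq yqr (lexx r).
have /tpiP Zm : tpi (iter k F y) = tpi x by rewrite (iter_lift _ _ lF) yz tpi_repr.
set m := iter k F y - x in Zm.
exists (q' - m); first by rewrite /= (tpiD _ (int_latticeN Zm)).
have -> : x - (q' - m) = iter k F y - q'.
  by rewrite /m; apply/rowP => i; rewrite !mxE; ring.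
have /andP[H _] := HC (tpi (iter k F y)) (iter k F y - q').
rewrite -(ler_pM2l c0) (le_trans H) // (le_trans Hq') //.
by rewrite -ler_pdivlMr.
Qed.

Theorem theorem1p5 (R : realType) (n : nat) (hn : n = 3%N \/ n = 4%N)
    (f : torus R n -> torus R n)
    (Es Ec Eu : torus R n -> {vspace 'rV[R]_n})
    (hf : partially_hyperbolic f Es Ec Eu)
    (hdim : forall p, \dim (Es p) = 1%N /\ \dim (Ec p) = 1%N)
    (Wc : torus R n -> set (torus R n))
    (hWc : center_foliation f Ec Wc)
    (hconj : leaf_conjugate_to_linear f Wc)
    (T : set (torus R n))
    (hT : compact_cu_submanifold Ec Eu T) :
  forall x, T x -> ~ (Wc x `<=` T).
Proof.
move=> x Tx WT.
have [d [S [i [cS iT]]]] := hT.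
have clT := tangent_immersion_closed iT cS.
have tanT := tangent_immersion_tangent_set iT.
have shadow := shadowing hf clT tanT.
have [A [Vs [Vc [Vu [_ phA [dimVs _] [psi [psi' [_ cpsi' psiK psi'K Hpsi]]]]]]]] := hconj.
have [[[_ _ _] spl] [ne0 [f' [F [F' [[ff' f'f lF lF'] _]]]]]] := hf.
have [[Wx _ _ _] _] := hWc.
(* The point lies on the image under the automorphism of the linear center leaf through [tpi a]. The
   center component [v] found there is mapped to another vector of [Vc]. *)
have psi_f (a : 'rV[R]_n) : exists2 c, c \in Vc &
    psi (f (psi' (tpi a))) = tpi (a *m map_mx intr A + c).
  have [H1 H2] := Hpsi (psi' (tpi a)).
  have : (psi @` (f @` Wc (psi' (tpi a)))) (psi (f (psi' (tpi a)))).
    by exists (f (psi' (tpi a))) => //; exists (psi' (tpi a)).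
  rewrite H2 H1 psi'K => -[_ [v vV <-] <-]; rewrite toral_map_tpi.
  have [m Zm ->] := repr_tpi a.
  exists (v *m map_mx intr A); first exact: (toral_center_mem phA).
  by rewrite addrAC mulmxDl tpiD ?mulmxDl //; exact: int_lattice_mul.
(* Translated by [psi], the assumption says that the whole linear center leaf through [psi x] is
   carried into [T] by [psi']. *)
have Tc c : c \in Vc -> T (psi' (tpi (repr (psi x) + c))).
  move=> cV; apply: WT; have [H _] := Hpsi x.
  have : linear_leaf Vc (psi x) (tpi (repr (psi x) + c)) by exists c.
  by rewrite -H => -[y Wy <-]; rewrite psiK.
have TT := center_leaf_dense phA psiK psi'K cpsi' psi_f f'f shadow clT dimVs Tc.
have [s0 _ _] := ne0 (tpi 0); have [dir full] := spl (tpi 0).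
have [scu0 _] := directv3_capv dir; rewrite -addvA in full.
by have := tangent_immersion_neq_setT iT cS s0 scu0 full; rewrite TT eqxx.
Qed.
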